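(* Let $r\ge1$ and $N\ge0$ be integers. For real $s>0$, put $$R^{(2)}_{s,r,N}=\frac1{\beta(s)^r}-\sum_{n=0}^{N}\frac{b_{s,r,n}}{2^n}.$$ Then, for $1/2<\rho<1$, $$0<R^{(2)}_{s,r,N}\le\left(\frac1{2\rho}\right)^{N+1}F_s\!\left(\frac{\rho}{1-\rho}\right)^{-r}$$ and $$R^{(2)}_{s,r,N}\le(1-\rho)^{-r}\left(\frac1{2\rho}\right)^{N+1}.$$ If $s\ge2$, put $$R^{(3)}_{s,r,N}=\frac1{\beta(s)^r}-\sum_{n=0}^{N}\frac{c_{s,r,n}}{3^n}.$$ Then, for $1/3<\rho<1$, $$0<R^{(3)}_{s,r,N}\le\left(\frac1{3\rho}\right)^{N+1}F_s\!\left(\frac{2\rho}{1-\rho}\right)^{-r}.$$ Moreover, $$R^{(3)}_{s,r,N}\le\left(\frac{1+\rho}{1-\rho}\right)^{r}\left(\frac1{3\rho}\right)^{N+1}.$$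
   Context: For real $s>0$, $\beta(s)=\sum_{k=0}^{\infty}\frac{(-1)^k}{(2k+1)^s}$ is the Dirichlet beta function, and $F_s$ is the analytic function on $\operatorname{Re}t>-1$ given by $$F_s(t)=\frac1{\Gamma(s)}\int_0^1\frac{(-\log x)^{s-1}}{1+tx^2}\,dx,$$ which is the analytic extension of $\sum_{k=0}^\infty\frac{(-1)^kt^k}{(2k+1)^s}$, $|t|<1$. For $|w|<1$ and $|u|<1$ put $H_s(w)=F_s\!\left(\frac{w}{1-w}\right)$ and $A_s(u)=F_s\!\left(\frac{2u}{1-u}\right)$; these functions are analytic and do not vanish in the unit disk, and take the value $1$ at $0$. The numbers $b_{s,r,n}$ and $c_{s,r,n}$ are the Taylor coefficients in $$H_s(w)^{-r}=\sum_{n=0}^\infty b_{s,r,n}w^n,\qquad A_s(u)^{-r}=\sum_{n=0}^\infty c_{s,r,n}u^n .$$ *)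

(* Defs.v *)
From mathcomp Require Export all_boot all_order all_algebra.
From mathcomp Require Export complex.
From mathcomp Require Export all_classical all_reals all_analysis.

Set Implicit Arguments.
Unset Strict Implicit.
Unset Printing Implicit Defensive.

Import Order.TTheory GRing.Theory Num.Theory.
Import numFieldNormedType.Exports.

Local Open Scope classical_set_scope.
Local Open Scope ring_scope.
Local Open Scope complex_scope.

(* Euler's integral for the Gamma function; meant for 0 < s. *)
Definition Gamma (R : realType) (s : R) : R :=
  \int[lebesgue_measure]_(x in `]0%R, +oo[) (x `^ (s - 1) * expR (- x)).

(* For 0 < s <= 1 the series converges only conditionally, so the sum is the
   limit of its partial sums. *)
Definition dirichlet_beta (R : realType) (s : R) : R :=
  limn (series (fun k => (-1) ^+ k / (k.*2.+1)%:R `^ s)).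

Definition Cintegral (R : realType) (D : set R) (f : R -> R[i]) : R[i] :=
  (\int[lebesgue_measure]_(x in D) complex.Re (f x)) +i*
  (\int[lebesgue_measure]_(x in D) complex.Im (f x)).

(* Meaningful for -1 < Re t. *)
Definition Fs (R : realType) (s : R) (t : R[i]) : R[i] :=
  ((Gamma s)^-1)%:C *
  Cintegral `]0, 1[
    (fun x => ((- ln x) `^ (s - 1))%:C / (1 + t * (x ^+ 2)%:C)).

Definition Hs (R : realType) (s : R) (w : R[i]) : R[i] := Fs s (w / (1 - w)).

Definition As (R : realType) (s : R) (u : R[i]) : R[i] :=
  Fs s (2%:R * u / (1 - u)).

(* n-th Taylor coefficient at 0, with iterated complex derivatives: the
   regular module R[i]^o makes derive1n differentiate along R[i]. *)
Definition taylor_coef (R : realType) (f : R[i] -> R[i]) (n : nat) : R[i] :=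
  (derive1n n (f : R[i]^o -> R[i]^o) 0) / n`!%:R.

Definition coef_b (R : realType) (s : R) (r n : nat) : R[i] :=
  taylor_coef (fun w => Hs s w ^- r) n.

Definition coef_c (R : realType) (s : R) (r n : nat) : R[i] :=
  taylor_coef (fun u => As s u ^- r) n.

Definition rem2 (R : realType) (s : R) (r N : nat) : R[i] :=
  (dirichlet_beta s ^- r)%:C - \sum_(0 <= n < N.+1) coef_b s r n / 2%:R ^+ n.

Definition rem3 (R : realType) (s : R) (r N : nat) : R[i] :=
  (dirichlet_beta s ^- r)%:C - \sum_(0 <= n < N.+1) coef_c s r n / 3%:R ^+ n.

(* Main.v *)
Require Import Defs.
From mathcomp Require Import ring lra measurable_realfun.

(** Both remainders are instances of one argument. Fix [c], which is [1] for the
    first expansion and [2] for the second, and write [z x = 1 - c * x ^ 2]. Let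
    the mean of a function on (0, 1) be its integral against the probability
    density [(- ln x) ^ (s - 1) / Gamma s]. Since
    [1 / (1 + (c * w / (1 - w)) * x ^ 2) = (1 - w) / (1 - w * z x)], the function
    [w |-> Fs s (c * w / (1 - w))] equals [1 - P w], where [P w] is the mean of
    [w * c * x ^ 2 / (1 - w * z x)]. The Taylor coefficients of [P] are the
    means [p (n + 1)] of [c * x ^ 2 * z x ^ n]. If they are nonnegative and
    [p 1 > 0], then [(1 - P) ^ - r] has positive Taylor coefficients, and its
    remainder of order [N + 1] at the point [w] where [c * w / (1 - w) = 1] is a
    positive sum, at most [(w / rho) ^ (N + 1)] times the value at [rho]. At
    that point [1 - P w] is [Fs s 1], the Dirichlet beta function. The explicit
    bounds follow from [1 - w * z x <= 1] when [c = 1] and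
    [1 - w * z x <= 1 + w] when [c = 2].

    Positivity is clear for [c = 1], where [z] has values in (0, 1). For [c = 2]
    the variable [z] changes sign under the reflection exchanging [x] and
    [sqrt (1 - x ^ 2)]. If [x < y] are exchanged, then
    [y * - ln y <= x * - ln x] by concavity of the logarithm ([mul_ln_swap]);
    with [2 <= s] this makes the weight at positive [z] dominate the weight at
    the opposite value ([log_mean_pairing]).

    The expansions are handled without infinite series. Over the reals, a
    function is [sum_(k < N) a k * w ^ k + w ^ N * T N w], and what is carried
    along is that every tail [T N] is positive and nondecreasing on [0, 1). This
    passes to products ([pos_tailsM]) and from [P] to [1 / (1 - P)]
    ([pos_tails_geometric]), and it contains the remainder estimate
    ([pos_tails_remainder]). Over the complex numbers, the Taylor coefficients
    at [0] are computed by jets, that is by chains of derivatives near [0]; means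
    of powers of the resolvent [1 / (1 - w * z x)] can be differentiated under
    the integral sign ([is_derive_resolvent_mean]), and the jet of an inverse is
    determined by the renewal equation ([has_jet_geometric]), which is also the
    recursion satisfied by the coefficients of [1 / (1 - P)]. *)

Import Order.TTheory GRing.Theory Num.Theory.
Import numFieldNormedType.Exports.

Set Implicit Arguments.
Unset Strict Implicit.
Unset Printing Implicit Defensive.

Local Open Scope classical_set_scope.
Local Open Scope ring_scope.
Local Open Scope complex_scope.

(** * Substitution in improper integrals of nonnegative functions *)

Section substitution.
Variable R : realType.
Notation mu := (@lebesgue_measure R).

(** Applying the change of variables on compact intervals that exhaust [D], and
    then monotone convergence, removes every condition on the behaviour of [F]
    and [G] at the ends of [D]. *)
Lemma ge0_integration_by_substitution_exhaustion (F dF G : R -> R) (D : set R)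
    (u v : nat -> R) :
  open D -> D = \bigcup_n `[u n, v n]%classic ->
  (forall n, u n <= v n) ->
  {homo u : n m / (n <= m)%N >-> m <= n} -> {homo v : n m / (n <= m)%N >-> n <= m} ->
  (forall x, D x -> is_derive x 1 F (dF x)) ->
  (forall x, D x -> {for x, continuous dF}) ->
  (forall x, D x -> dF x <= 0) ->
  (forall x y, D x -> D y -> x < y -> F y < F x) ->
  (forall x, D x -> {for F x, continuous G}) ->
  (forall x, D x -> 0 <= G (F x)) ->
  (\int[mu]_(x in F @` D) (G x)%:E = \int[mu]_(x in D) (G (F x) * - dF x)%:E)%E.
Proof.
move=> oD DE uv hu hv dFE cdF dF0 Fdec cG G0.
have inD n x : u n <= x <= v n -> D x by move=> xn; rewrite DE; exists n.
have cF x : D x -> {for x, continuous F}.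
  move=> Dx; have [d _] := dFE _ Dx.
  exact/differentiable_continuous/derivable1_diffP.
have Dnear x : D x -> \forall y \near x, D y by move=> Dx; exact: open_nbhs_nbhs.
have F'E x : D x -> derive1 F x = dF x.
  by move=> Dx; rewrite derive1E; have [_] := dFE _ Dx.
have cF' x : D x -> {for x, continuous (derive1 F)}.
  move=> Dx; have := cdF x Dx; rewrite /prop_for /continuous_at F'E //.
  apply: cvg_trans; apply: near_eq_cvg; near=> y.
  by rewrite F'E //; near: y; exact: Dnear.
have Fle x y : D x -> D y -> x <= y -> F y <= F x.
  move=> Dx Dy; rewrite le_eqVlt => /predU1P[->//|xy].
  by apply: ltW; exact: Fdec.
have Du n : D (u n) by apply: (inD n); rewrite lexx uv.
have Dv n : D (v n) by apply: (inD n); rewrite uv lexx.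
have FDE : F @` D = \bigcup_n `[F (v n), F (u n)]%classic.
  apply/seteqP; split => [_ [x Dx <-]|y [n _ /=]].
    move: (Dx); rewrite DE => -[n _ /=]; rewrite in_itv /= => /andP[ux xv].
    by exists n => //=; rewrite in_itv /= !Fle.
  rewrite in_itv /= => yF.
  have [||x] := @IVT _ F _ _ y (uv n).
  - apply: continuous_in_subspaceT => x; rewrite inE /= in_itv /= => xn.
    exact/cF/(inD n).
  - by rewrite min_r ?max_l ?Fle.
  - by rewrite in_itv /= => xn <-; exists x => //; exact: (inD n).
have cGin n : {within `[F (v n), F (u n)], continuous G}.
  apply: continuous_in_subspaceT => y; rewrite inE /= => yn.
  have [x Dx <-] : (F @` D) y by rewrite FDE; exists n.
  exact: cG.
have cGFin n : {within `[u n, v n], continuous (fun x => G (F x) * - dF x)}.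
  apply: continuous_in_subspaceT => x; rewrite inE /= in_itv /= => xn.
  have Dx := inD _ _ xn.
  apply: cvgM; last by apply: cvgN; exact: cdF.
  by apply: (@continuous_comp _ _ _ F G); [exact: cF|exact: cG].
have intE n : (\int[mu]_(x in `[F (v n), F (u n)]) (G x)%:E =
    \int[mu]_(x in `[u n, v n]) (G (F x) * - dF x)%:E)%E.
  rewrite (integration_by_substitution_decreasing (uv n)); first last.
  - exact: cGin.
  - split.
    + move=> x; rewrite in_itv /= => /andP[ux xv].
      have [] // := dFE x; apply: (inD n); by rewrite !ltW.
    + by apply: cvg_at_right_filter; exact: cF.
    + by apply: cvg_at_left_filter; exact: cF.
  - by apply/cvg_ex; exists (derive1 F (v n)); apply: cvg_at_left_filter; exact: cF'.
  - by apply/cvg_ex; exists (derive1 F (u n)); apply: cvg_at_right_filter; exact: cF'.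
  - move=> x; rewrite in_itv /= => /andP[ux xv].
    by apply/cF'/(inD n); rewrite !ltW.
  - move=> x y; rewrite !in_itv /= => xn yn.
    by apply: Fdec; apply: (inD n).
  apply: eq_integral => x; rewrite inE /= in_itv /= => xn.
  by rewrite /= !fctE F'E //; exact: (inD n).
have ndD : nondecreasing_seq (fun n => `[u n, v n]%classic : set R).
  move=> n m nm; rewrite subsetEset => x /=; rewrite !in_itv /= => /andP[ux xv].
  by rewrite (le_trans (hu _ _ nm) ux) (le_trans xv (hv _ _ nm)).
have ndFD : nondecreasing_seq (fun n => `[F (v n), F (u n)]%classic : set R).
  move=> n m nm; rewrite subsetEset => x /=; rewrite !in_itv /= => /andP[vx xu].
  by rewrite (le_trans _ vx) ?(le_trans xu) // Fle // ?hu ?hv.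
have cvgG : (\int[mu]_(x in `[F (v n), F (u n)]) (G x)%:E)%E @[n --> \oo] -->
    (\int[mu]_(x in \bigcup_n `[F (v n), F (u n)]%classic) (G x)%:E)%E.
  apply: (ge0_nondecreasing_set_cvg_integral (T := measurableTypeR R) ndFD)
    => // [n|n y yn].
    by apply/measurable_EFinP; exact: subspace_continuous_measurable_fun.
  have [x Dx <-] : (F @` D) y by rewrite FDE; exists n.
  by rewrite lee_fin G0.
have cvgGF : (\int[mu]_(x in `[u n, v n]) (G (F x) * - dF x)%:E)%E @[n --> \oo] -->
    (\int[mu]_(x in \bigcup_n `[u n, v n]%classic) (G (F x) * - dF x)%:E)%E.
  apply: (ge0_nondecreasing_set_cvg_integral (T := measurableTypeR R) ndD)
    => // [n|n x /=].
    by apply/measurable_EFinP; exact: subspace_continuous_measurable_fun.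
  rewrite in_itv /= => /inD Dx.
  by rewrite lee_fin mulr_ge0 ?G0 // oppr_ge0 dF0.
rewrite FDE [in RHS]DE -(cvg_lim (@ereal_hausdorff R) cvgG).
rewrite -(cvg_lim (@ereal_hausdorff R) cvgGF).
by congr (lim (_ @ \oo)); apply/funext => n; exact: intE.
Unshelve. all: by end_near. Qed.

End substitution.

(** * The logarithmic weight and the Gamma integral *)

Section gamma_weight.
Variable R : realType.
Notation mu := (@lebesgue_measure R).
Notation pos := (`]0%R, +oo[%classic : set R).
Notation unit := (`]0%R, 1%R[%classic : set R).

Lemma continuous_powR (a x : R) : 0 < x -> {for x, continuous (fun t : R => t `^ a)}.
Proof.
move=> x0; have [d _] := is_derive1_powR a x0.
exact/differentiable_continuous/derivable1_diffP.
Qed.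

Lemma itv_0y_bigcup : pos = \bigcup_n `[n.+1%:R^-1, n.+1%:R]%classic.
Proof.
apply/seteqP; split=> [x /=|x [n _ /=]]; rewrite !in_itv /=.
  rewrite andbT => x0; pose y := Num.max x x^-1.
  have [n yn] : exists n : nat, y <= n%:R.
    exists (Num.bound y); apply: ltW; apply: le_lt_trans (archi_boundP _).
      by [].
    by rewrite /y le_max ltW.
  (* Both [x] and its inverse are to be at most [n + 1]. *)
  have {}yn : y <= n.+1%:R by rewrite (le_trans yn) // ler_nat.
  exists n => //=; rewrite in_itv /= (le_trans _ yn) ?le_max ?lexx // andbT.
  rewrite -[x]invrK lef_pV2 ?posrE ?invr_gt0 //.
  by rewrite (le_trans _ yn) // le_max lexx orbT.
by case/andP => nx _; rewrite andbT (lt_le_trans _ nx) // invr_gt0.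
Qed.

Lemma ge0_integration_by_substitution_pos (F dF G : R -> R) :
  (forall x : R, 0 < x -> is_derive x 1 F (dF x)) ->
  (forall x : R, 0 < x -> {for x, continuous dF}) ->
  (forall x : R, 0 < x -> dF x <= 0) ->
  (forall x y : R, 0 < x -> x < y -> F y < F x) ->
  F @` pos = unit ->
  (forall x, unit x -> {for x, continuous G}) ->
  (forall x, unit x -> 0 <= G x) ->
  (\int[mu]_(x in unit) (G x)%:E = \int[mu]_(x in pos) (G (F x) * - dF x)%:E)%E.
Proof.
move=> dFE cdF dF0 Fdec FE cG G0.
have pos0 x : pos x -> 0 < x by rewrite /= in_itv /= andbT.
have unitF x : pos x -> unit (F x) by move=> px; rewrite -FE; exists x.
rewrite -FE; apply: (ge0_integration_by_substitution_exhaustion _ itv_0y_bigcup).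
- exact: interval_open.
- by move=> n; rewrite (@le_trans _ _ 1) ?invf_le1 ?ler1n ?ltr0n.
- by move=> n m nm; rewrite lef_pV2 ?posrE ?ltr0n // ler_nat ltnS.
- by move=> n m nm; rewrite ler_nat ltnS.
- by move=> x /pos0; exact: dFE.
- by move=> x /pos0; exact: cdF.
- by move=> x /pos0; exact: dF0.
- by move=> x y /pos0 x0 _; exact: Fdec.
- by move=> x /unitF; exact: cG.
- by move=> x /unitF; exact: G0.
Qed.

(** The rate [c] is free: comparing two rates gives the scaling rule for the
    moments of the logarithmic weight. *)
Lemma ge0_integral_unit_expR (c : R) (G : R -> R) : 0 < c ->
  (forall x, unit x -> {for x, continuous G}) ->
  (forall x, unit x -> 0 <= G x) ->
  (\int[mu]_(x in unit) (G x)%:E =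
   \int[mu]_(t in pos) (G (expR (- (c * t))) * (c * expR (- (c * t))))%:E)%E.
Proof.
move=> c0 cG G0.
have dF (x : R) : 0 < x ->
    is_derive x 1 (fun t => expR (- (c * t))) (- (c * expR (- (c * x)))).
  move=> _; rewrite mulrC -mulrN.
  apply: (@is_derive1_comp R expR (fun t => - (c * t)) x (expR (- (c * x))) (- c)).
  by apply: is_derive_eq; rewrite /GRing.scale /= mulr1.
rewrite (ge0_integration_by_substitution_pos dF) //.
- by apply: eq_integral => t _; rewrite opprK.
- move=> x _; apply: cvgN; apply: cvgM; first exact: cvg_cst.
  apply: (@continuous_comp _ _ _ (fun t => - (c * t)) expR); last exact: continuous_expR.
  by apply: cvgN; apply: cvgM; [exact: cvg_cst|exact: cvg_id].
- by move=> x _; rewrite oppr_le0 mulr_ge0 ?expR_ge0 // ltW.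
- by move=> x y _ xy; rewrite ltr_expR ltrN2 ltr_pM2l.
- apply/seteqP; split=> [_ [t /= + <-]|y /=]; rewrite !in_itv /= ?andbT.
    by move=> t0; rewrite expR_gt0 /= expR_lt1 oppr_lt0 mulr_gt0.
  move=> /andP[y0 y1]; exists (- ln y / c); last first.
    by rewrite mulrC divfK ?gt_eqF // opprK lnK.
  by rewrite /= in_itv /= andbT divr_gt0 // oppr_gt0 ln_lt0 // y0.
Qed.

Definition log_weight (s x : R) : R := (- ln x) `^ (s - 1).

Lemma log_weight_ge0 s x : 0 <= log_weight s x.
Proof. exact: powR_ge0. Qed.

Lemma continuous_log_weight s x : unit x -> {for x, continuous (log_weight s)}.
Proof.
rewrite /= in_itv /= => /andP[x0 x1].
apply: (@continuous_comp _ _ _ (fun x => - ln x) (fun t : R => t `^ (s - 1))).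
  by apply: cvgN; exact: continuous_ln.
by apply: continuous_powR; rewrite oppr_gt0 ln_lt0 // x0.
Qed.

Lemma measurable_log_weight s (D : set R) : measurable D ->
  measurable_fun D (log_weight s).
Proof.
move=> mD; apply: measurable_funTS.
have -> : log_weight s = (fun t : R => t `^ (s - 1)) \o (fun x => - ln x) by [].
apply: measurableT_comp; first exact: measurable_powR.
by apply: measurableT_comp => //; exact: measurable_ln.
Qed.

Lemma integral_log_weight s :
  (\int[mu]_(x in unit) (log_weight s x)%:E =
   \int[mu]_(t in pos) (t `^ (s - 1) * expR (- t))%:E)%E.
Proof.
rewrite (@ge0_integral_unit_expR 1) //; last 2 first.
- exact: continuous_log_weight.
- by move=> x _; exact: log_weight_ge0.
apply: eq_integral => t _.
by rewrite /log_weight !mul1r expRK opprK.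
Qed.

(** Substituting [x = exp (- (n + 1) * t)] in the integral of the weight, and
    [x = exp (- t)] in the integral with the factor [x ^ n], gives the same
    integral over the half line up to the factor [(n + 1) ^ s]. *)
Lemma integral_log_weight_expr s n :
  ((n.+1%:R `^ s)%:E * \int[mu]_(x in unit) (log_weight s x * x ^+ n)%:E =
   \int[mu]_(x in unit) (log_weight s x)%:E)%E.
Proof.
have n0 : 0 < n.+1%:R :> R by rewrite ltr0n.
rewrite [RHS](@ge0_integral_unit_expR n.+1%:R) //; last 2 first.
- exact: continuous_log_weight.
- by move=> x _; exact: log_weight_ge0.
rewrite (@ge0_integral_unit_expR 1) //; last 2 first.
- move=> x xu; apply: cvgM; first exact: continuous_log_weight.
  exact: exprn_continuous.
- move=> x; rewrite /= in_itv /= => /andP[x0 x1].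
  by rewrite mulr_ge0 ?log_weight_ge0 // exprn_ge0 // ltW.
rewrite -ge0_integralZl_EFin ?powR_ge0 //; last 2 first.
- move=> t _; rewrite lee_fin !mulr_ge0 ?log_weight_ge0 ?exprn_ge0 ?expR_ge0 //.
- apply/measurable_EFinP; apply: measurable_funTS.
  have mF : measurable_fun setT (fun t : R => expR (- (1 * t))).
    under eq_fun do rewrite mul1r.
    by apply: measurableT_comp => //; exact: measurableT_comp.
  apply: measurable_funM; last by apply: measurable_funM.
  apply: measurable_funM; last exact: measurable_funX.
  by apply: (measurableT_comp _ mF); exact: measurable_log_weight.
apply: eq_integral => t; rewrite inE /= in_itv /= andbT => t0.
rewrite -EFinM; congr EFin.
rewrite /log_weight !expRK !opprK !mul1r powRM ?(ltW t0) ?(ltW n0) //.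
have -> : n.+1%:R `^ s = n.+1%:R `^ (s - 1) * n.+1%:R :> R.
  rewrite -[X in _ = _ * X](powRr1 (ltW n0)) -powRD ?subrK //.
  by rewrite (gt_eqF n0) implybT.
by rewrite -mulrN expRM_natl exprSr; ring.
Qed.

(** Since [t / (2 * s) <= exp (t / (2 * s))], raising to the power [2 * s]
    bounds [t ^ (2 * s)] by a multiple of [exp t]. *)
Lemma powR_expR_bound (s t : R) : 0 < s -> 0 < t ->
  (1 + t `^ s) ^+ 2 <= (2 + 2 * (2 * s) `^ (2 * s)) * expR t.
Proof.
move=> s0 t0; have s2 : 0 < 2 * s by rewrite mulr_gt0.
have ts : (t `^ s) ^+ 2 <= (2 * s) `^ (2 * s) * expR t.
  rewrite -powR_mulrn ?powR_ge0 // -powRrM mulrC.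
  have -> : expR t = expR (t / (2 * s)) `^ (2 * s).
    by rewrite -expRM divfK // gt_eqF.
  rewrite -powRM ?expR_ge0 ?(ltW s2) //.
  apply: ge0_ler_powR.
  - exact: ltW.
  - by rewrite nnegrE ltW.
  - by rewrite nnegrE mulr_ge0 ?expR_ge0 // ltW.
  rewrite mulrC -ler_pdivrMr // (le_trans _ (expR_ge1Dx _)) //.
  by rewrite lerDr ler01.
have e1 : 1 <= expR t by rewrite -expR0 ler_expR ltW.
have t1 : (1 + t `^ s) ^+ 2 <= 2 + 2 * (t `^ s) ^+ 2.
  by have := sqr_ge0 (1 - t `^ s); rewrite -subr_ge0; set u := t `^ s; nra.
apply: (le_trans t1); move: ts; set K := (2 * s) `^ (2 * s) => ts.
have -> : (2 + 2 * K) * expR t = 2 * expR t + 2 * (K * expR t) by ring.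
by lra.
Qed.

(** The function [t |-> 1 / (1 + t ^ s)] decreases from [1] to [0], so the
    integral over (0, +oo) of minus its derivative,
    [s * t ^ (s - 1) / (1 + t ^ s) ^ 2], is [1]. By [powR_expR_bound] this
    derivative dominates the integrand of the Gamma integral, at both ends at
    once and for every [s > 0]. *)
Lemma integral_log_weight_lty (s : R) : 0 < s ->
  (\int[mu]_(x in unit) (log_weight s x)%:E < +oo)%E.
Proof.
move=> s0; set C := 2 + 2 * (2 * s) `^ (2 * s).
have C0 : 0 < C by rewrite ltr_wpDr // mulr_ge0 // powR_ge0.
pose F (t : R) := (1 + t `^ s)^-1.
pose dF (t : R) := - (1 + t `^ s) ^- 2 * (s * t `^ (s - 1)).
have d0 t : 0 < 1 + t `^ s by rewrite ltr_pwDl // powR_ge0.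
have FdF (t : R) : 0 < t -> is_derive t 1 F (dF t).
  move=> t0; apply: is_deriveV; first by rewrite gt_eqF.
  have dp := is_derive1_powR s t0.
  have := is_deriveD (is_derive_cst (1 : R) t 1) dp.
  by rewrite add0r.
have intdF : (\int[mu]_(t in pos) (1 * - dF t)%:E = 1)%E.
  rewrite -(@ge0_integration_by_substitution_pos F dF (fun=> 1)) //.
  - rewrite integral_cst //= mul1e lebesgue_measure_itv /=.
    by rewrite lte_fin ltr01 -EFinD subr0.
  - move=> t t0; apply: cvgM; last first.
      by apply: cvgM; [exact: cvg_cst|exact: continuous_powR].
    apply: cvgN; apply: cvgV; first by rewrite expf_neq0 // gt_eqF.
    apply: (@continuous_comp _ _ _ (fun t => 1 + t `^ s) (fun y => y ^+ 2)).
      by apply: cvgD; [exact: cvg_cst|exact: continuous_powR].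
    exact: exprn_continuous.
  - move=> t t0; rewrite /dF mulNr oppr_le0 !mulr_ge0 ?powR_ge0 ?(ltW s0) //.
    by rewrite invr_ge0 exprn_ge0 // ltW.
  - move=> x y x0 xy; rewrite ltf_pV2 ?posrE // ltrD2l.
    by rewrite gt0_ltr_powR // nnegrE ltW // (lt_trans x0).
  - apply/seteqP; split=> [_ [t /= + <-]|y /=]; rewrite !in_itv /= ?andbT.
      move=> t0; rewrite invr_gt0 d0 /= invf_lt1 // ltrDl powR_gt0 //.
    move=> /andP[y0 y1]; have y1' : 0 < y^-1 - 1.
      by rewrite subr_gt0 invf_gt1.
    exists ((y^-1 - 1) `^ s^-1); first by rewrite /= in_itv /= andbT powR_gt0.
    by rewrite /F -powRrM mulVf ?gt_eqF // powRr1 ?(ltW y1') // addrC subrK invrK.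
  - by move=> t _; exact: cvg_cst.
have mdF : measurable_fun pos dF.
  apply: open_continuous_measurable_fun; first exact: interval_open.
  move=> t; rewrite inE /= in_itv /= andbT => t0; apply: cvgM; last first.
    by apply: cvgM; [exact: cvg_cst|exact: continuous_powR].
  apply: cvgN; apply: cvgV; first by rewrite expf_neq0 // gt_eqF.
  apply: (@continuous_comp _ _ _ (fun t => 1 + t `^ s) (fun y => y ^+ 2)).
    by apply: cvgD; [exact: cvg_cst|exact: continuous_powR].
  exact: exprn_continuous.
rewrite integral_log_weight.
apply: (@le_lt_trans _ _ (\int[mu]_(t in pos) ((C / s)%:E * (1 * - dF t)%:E))%E).
  apply: ge0_le_integral => //.
  - by move=> t _; rewrite lee_fin mulr_ge0 ?powR_ge0 ?expR_ge0.
  - apply/measurable_EFinP; apply: measurable_funTS; apply: measurable_funM.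
      exact: measurable_powR.
    by apply: measurableT_comp.
  - apply: emeasurable_funM => //; apply/measurable_EFinP.
    by apply: measurable_funM => //; exact: measurableT_comp.
  - move=> t; rewrite /= in_itv /= andbT => t0.
    rewrite -EFinM lee_fin mul1r /dF mulNr opprK.
    have -> : C / s * ((1 + t `^ s) ^- 2 * (s * t `^ (s - 1))) =
      t `^ (s - 1) * (C / (1 + t `^ s) ^+ 2).
      by field; rewrite !gt_eqF // expr_gt0.
    rewrite ler_wpM2l ?powR_ge0 // ler_pdivlMr ?exprn_gt0 // mulrC.
    by rewrite expRN ler_pdivrMr ?expR_gt0 // powR_expR_bound.
rewrite ge0_integralZl_EFin //.
- by rewrite intdF mule1 ltry.
- move=> t; rewrite /= in_itv /= andbT => t0; rewrite lee_fin mul1r /dF mulNr opprK.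
  by rewrite !mulr_ge0 ?powR_ge0 ?(ltW s0) // invr_ge0 exprn_ge0 // ltW.
- apply/measurable_EFinP; apply: measurable_funM => //.
  exact: measurableT_comp.
- by rewrite divr_ge0 // ltW.
Qed.

End gamma_weight.

(** * Means for the logarithmic weight *)

Section log_mean.
Variables (R : realType) (s : R).
Hypothesis s_gt0 : 0 < s.
Notation mu := (@lebesgue_measure R).
Notation unit := (`]0%R, 1%R[%classic : set R).

Lemma Gamma_log_weight :
  Gamma s = \int[mu]_(x in unit) log_weight s x.
Proof. by rewrite /Gamma /Rintegral integral_log_weight. Qed.

Lemma integrable_log_weight : mu.-integrable unit (EFin \o log_weight s).
Proof.
apply/integrableP; split.
  by apply/measurable_EFinP; exact: measurable_log_weight.
under eq_integral do rewrite /= ger0_norm ?log_weight_ge0 //.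
exact: integral_log_weight_lty.
Qed.

(** On the interval from [exp (-2)] to [exp (-1)] the value [- ln x] lies
    between [1] and [2], so the weight is at least [1 / 2] there for every
    [s > 0]. *)
Lemma Gamma_gt0 : 0 < Gamma s.
Proof.
rewrite Gamma_log_weight; pose a : R := expR (-2); pose b : R := expR (-1).
have ab : a < b by rewrite ltr_expR ltrN2 ltr1n.
have b1 : b < 1 by rewrite expR_lt1 oppr_lt0.
have sub : `[a, b]%classic `<=` unit.
  move=> x /=; rewrite !in_itv /= => /andP[ax xb].
  by rewrite (lt_le_trans (expR_gt0 _) ax) (le_lt_trans xb).
have muab : mu `[a, b]%classic = (b - a)%:E.
  by rewrite lebesgue_measure_itv /= lte_fin ab -EFinD.
apply: (@lt_le_trans _ _ (\int[mu]_(x in `[a, b]) 2^-1)).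
  rewrite Rintegral_cst //.
  rewrite (_ : fine _ = b - a); last first.
    by transitivity (fine (mu `[a, b]%classic)) => //; rewrite muab.
  by rewrite mulr_gt0 ?invr_gt0 // subr_gt0.
apply: (@le_trans _ _ (\int[mu]_(x in `[a, b]) log_weight s x)).
  apply: le_Rintegral => //.
  - apply: measurable_bounded_integrable => //.
      by apply: (@le_lt_trans _ _ (b - a)%:E); rewrite ?ltry // -muab.
    by exists 2^-1; split; [exact: num_real|move=> M /ltW + x _ /=; rewrite ger0_norm].
  - exact: integrableS integrable_log_weight.
  - move=> x /[dup] /sub; rewrite /= !in_itv /= => /andP[x0 x1] /andP[ax xb].
    have l1 : 1 <= - ln x.
      by rewrite lerNr -[leRHS]expRK ler_ln ?posrE ?expR_gt0.
    have l2 : - ln x <= 2.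
      by rewrite lerNl -[leLHS]expRK ler_ln ?posrE ?expR_gt0.
    rewrite /log_weight (@le_trans _ _ ((- ln x) `^ (-1))) //.
      rewrite powR_inv1 ?(le_trans ler01) // lef_pV2 ?posrE //.
      exact: lt_le_trans ltr01 l1.
    by apply: ler_powR => //; rewrite lerBrDr addNr ltW.
rewrite /Rintegral fine_le //.
- by apply: integrable_fin_num => //; exact: integrableS integrable_log_weight.
- by apply: integrable_fin_num => //; exact: integrable_log_weight.
- apply: ge0_subset_integral => //.
    by apply/measurable_EFinP; exact: measurable_log_weight.
  by move=> x _; rewrite lee_fin log_weight_ge0.
Qed.

Definition bmeas (f : R -> R) := measurable_fun unit f /\
  exists M, forall x, unit x -> `|f x| <= M.

Lemma bmeas_cst c : bmeas (fun=> c).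
Proof. by split => //; exists `|c|. Qed.

Lemma bmeasD f g : bmeas f -> bmeas g -> bmeas (fun x => f x + g x).
Proof.
move=> [mf [M fM]] [mg [L gL]]; split; first exact: measurable_funD.
by exists (M + L) => x ux; rewrite (le_trans (ler_normD _ _)) // lerD ?fM ?gL.
Qed.

Lemma bmeasM f g : bmeas f -> bmeas g -> bmeas (fun x => f x * g x).
Proof.
move=> [mf [M fM]] [mg [L gL]]; split; first exact: measurable_funM.
by exists (M * L) => x ux; rewrite normrM ler_pM ?fM ?gL.
Qed.

Lemma bmeasN f : bmeas f -> bmeas (fun x => - f x).
Proof.
move=> bf; have := bmeasM (bmeas_cst (-1)) bf.
by under eq_fun do rewrite mulN1r.
Qed.

Lemma bmeasB f g : bmeas f -> bmeas g -> bmeas (fun x => f x - g x).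
Proof. by move=> bf bg; apply: bmeasD => //; exact: bmeasN. Qed.

Lemma bmeasX f n : bmeas f -> bmeas (fun x => f x ^+ n).
Proof.
move=> bf; elim: n => [|n IH]; first exact: bmeas_cst.
by under eq_fun do rewrite exprS; exact: bmeasM.
Qed.

Lemma bmeas_id : bmeas (fun x => x).
Proof.
split => //; exists 1 => x; rewrite /= in_itv /= => /andP[x0 x1].
by rewrite ger0_norm ltW.
Qed.

Lemma bmeasV f d : 0 < d -> (forall x, unit x -> d <= f x) -> bmeas f ->
  bmeas (fun x => (f x)^-1).
Proof.
move=> d0 df [mf [M fM]]; split.
  apply: (@eq_measurable_fun _ _ _ _ _ (fun x => f x `^ (-1))).
    move=> x; rewrite inE => ux; rewrite powR_inv1 //.
    by rewrite (le_trans (ltW d0)) // df.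
  have -> : (fun x => f x `^ (-1)) = (fun t : R => t `^ (-1)) \o f by [].
  by apply: measurableT_comp => //; exact: measurable_powR.
exists d^-1 => x ux; have f0 := lt_le_trans d0 (df _ ux).
by rewrite ger0_norm ?invr_ge0 ?(ltW f0) // lef_pV2 ?posrE ?df.
Qed.

Lemma integrable_log_weightM f : bmeas f ->
  mu.-integrable unit (EFin \o (fun x => log_weight s x * f x)).
Proof.
move=> [mf [M fM]].
have bf : [bounded f x | x in unit].
  by exists M; split; [exact: num_real|
    move=> y /ltW My x ux; exact: le_trans (fM _ ux) My].
rewrite (_ : EFin \o _ = ((EFin \o log_weight s) \* (EFin \o f))%E) //.
by apply: integrableMl => //; exact: integrable_log_weight.
Qed.

Definition log_mean (f : R -> R) : R :=
  (Gamma s)^-1 * \int[mu]_(x in unit) (log_weight s x * f x).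

Lemma log_meanD f g : bmeas f -> bmeas g ->
  log_mean (fun x => f x + g x) = log_mean f + log_mean g.
Proof.
move=> bf bg; rewrite /log_mean -mulrDr; congr (_ * _).
rewrite -RintegralD //; try exact: integrable_log_weightM.
by apply: eq_Rintegral => x _; rewrite mulrDr.
Qed.

Lemma log_meanZ c f : bmeas f ->
  log_mean (fun x => c * f x) = c * log_mean f.
Proof.
move=> bf; rewrite /log_mean mulrCA; congr (_ * _).
rewrite -RintegralZl //; last exact: integrable_log_weightM.
by apply: eq_Rintegral => x _; rewrite mulrCA.
Qed.

Lemma log_meanB f g : bmeas f -> bmeas g ->
  log_mean (fun x => f x - g x) = log_mean f - log_mean g.
Proof.
move=> bf bg; rewrite log_meanD //; last exact: bmeasN.
congr (_ + _); rewrite -mulN1r -log_meanZ //.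
by congr log_mean; apply/funext => x; rewrite mulN1r.
Qed.

Lemma eq_log_mean f g : (forall x, unit x -> f x = g x) ->
  log_mean f = log_mean g.
Proof.
move=> fg; rewrite /log_mean; congr (_ * _); apply: eq_Rintegral => x.
by rewrite inE => ux; rewrite fg.
Qed.

Lemma le_log_mean f g : bmeas f -> bmeas g ->
  (forall x, unit x -> f x <= g x) -> log_mean f <= log_mean g.
Proof.
move=> bf bg fg; rewrite /log_mean ler_wpM2l ?invr_ge0 ?(ltW Gamma_gt0) //.
apply: le_Rintegral => //; try exact: integrable_log_weightM.
by move=> x ux; rewrite ler_wpM2l ?log_weight_ge0 ?fg.
Qed.

Lemma log_mean_cst c : log_mean (fun=> c) = c.
Proof.
rewrite /log_mean; under eq_Rintegral do rewrite mulrC.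
rewrite RintegralZl //; last exact: integrable_log_weight.
by rewrite -Gamma_log_weight mulrCA mulVf ?mulr1 // gt_eqF // Gamma_gt0.
Qed.

Lemma log_mean_ge0 f : bmeas f -> (forall x, unit x -> 0 <= f x) ->
  0 <= log_mean f.
Proof.
move=> bf f0; rewrite -(log_mean_cst 0) le_log_mean //; exact: bmeas_cst.
Qed.

Lemma log_mean_bound f M : bmeas f -> (forall x, unit x -> `|f x| <= M) ->
  `|log_mean f| <= M.
Proof.
move=> bf fM; have fM' x : unit x -> - M <= f x <= M.
  by move=> /fM; rewrite ler_norml.
rewrite ler_norml; apply/andP; split.
  rewrite -[leLHS]log_mean_cst; apply: le_log_mean => //; first exact: bmeas_cst.
  by move=> x /fM' /andP[].
rewrite -[leRHS]log_mean_cst; apply: le_log_mean => //; first exact: bmeas_cst.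
by move=> x /fM' /andP[].
Qed.

Lemma log_mean_expr n : log_mean (fun x => x ^+ n) = (n.+1%:R `^ s)^-1.
Proof.
have n0 : 0 < n.+1%:R `^ s :> R by rewrite powR_gt0.
rewrite /log_mean; set I := Rintegral _ _ _.
have : n.+1%:R `^ s * I = Gamma s.
  have fI : (\int[mu]_(x in unit) (log_weight s x * x ^+ n)%:E)%E \is a fin_num.
    apply: integrable_fin_num => //.
    by apply: integrable_log_weightM; apply: bmeasX; exact: bmeas_id.
  apply: EFin_inj; rewrite EFinM [X in (_ * X)%E]fineK // integral_log_weight_expr.
  rewrite Gamma_log_weight fineK //.
  by apply: integrable_fin_num => //; exact: integrable_log_weight.
move=> GE; apply: (mulfI (lt0r_neq0 n0)).
by rewrite mulrCA GE mulVf ?mulfV // gt_eqF // Gamma_gt0.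
Qed.

End log_mean.

(** * The beta function as a mean *)

Section beta.
Variables (R : realType) (s : R).
Hypothesis s_gt0 : 0 < s.

(** The terms of the series are the means of [(- x ^ 2) ^ k], and the remainder
    of the geometric series for [1 / (1 + x ^ 2)] is at most [x ^ (2 * n)] in
    absolute value; its mean is at most [(2 * n + 1) ^ - s]. *)
Lemma dirichlet_beta_log_mean :
  dirichlet_beta s = log_mean s (fun x => (1 + x ^+ 2)^-1).
Proof.
have bsq : bmeas (fun x : R => - x ^+ 2).
  by apply: bmeasN; apply: bmeasX; exact: bmeas_id.
have bV : bmeas (fun x : R => (1 + x ^+ 2)^-1).
  apply: (@bmeasV _ _ 1) => //; first by move=> x _; rewrite lerDl sqr_ge0.
  by apply: bmeasD; [exact: bmeas_cst|apply: bmeasX; exact: bmeas_id].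
pose rem n := log_mean s (fun x => (- x ^+ 2) ^+ n * (1 + x ^+ 2)^-1).
have brem n : bmeas (fun x : R => (- x ^+ 2) ^+ n * (1 + x ^+ 2)^-1).
  by apply: bmeasM => //; exact: bmeasX.
have termE n : (-1) ^+ n / (n.*2.+1)%:R `^ s =
    log_mean s (fun x => (- x ^+ 2) ^+ n).
  rewrite -log_mean_expr // -log_meanZ //; last by apply: bmeasX; exact: bmeas_id.
  congr log_mean; apply/funext => x.
  by rewrite [in RHS]exprNn -exprM mul2n.
have serE n : series (fun k => (-1) ^+ k / (k.*2.+1)%:R `^ s) n =
    log_mean s (fun x => (1 + x ^+ 2)^-1) - rem n.
  elim: n => [|n IH].
    rewrite /series /= big_geq //; apply/esym/eqP; rewrite subr_eq0.
    by apply/eqP; congr log_mean; apply/funext => x; rewrite expr0 mul1r.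
  rewrite /series /= big_nat_recr //= -[X in X + _]/(series _ n) IH termE.
  have -> : log_mean s (fun x => (- x ^+ 2) ^+ n) = rem n - rem n.+1.
    rewrite -log_meanB //; congr log_mean; apply/funext => x.
    have : 1 + x ^+ 2 != 0 by rewrite gt_eqF // ltr_pwDl // sqr_ge0.
    by rewrite [_ ^+ n.+1]exprS; set u := (- x ^+ 2) ^+ n => ?; field.
  by rewrite addrA subrK.
have remB n : `|rem n| <= (n.*2.+1)%:R^-1 `^ s.
  have -> : (n.*2.+1)%:R^-1 `^ s = log_mean s (fun x => x ^+ n.*2).
    by rewrite log_mean_expr // -powR_inv1 // -powRrM mulN1r powRN.
  have bsqn : bmeas (fun x : R => x ^+ n.*2) by apply: bmeasX; exact: bmeas_id.
  have remN (x : R) : `|(- x ^+ 2) ^+ n * (1 + x ^+ 2)^-1| <= x ^+ n.*2.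
    have -> : x ^+ n.*2 = (x ^+ 2) ^+ n by rewrite -exprM mul2n.
    rewrite normrM normrX normrN (ger0_norm (sqr_ge0 x)).
    rewrite [X in _ * X]ger0_norm ?invr_ge0 ?addr_ge0 ?sqr_ge0 //.
    apply: ler_piMr; first by rewrite exprn_ge0 ?sqr_ge0.
    by rewrite invf_le1 ?lerDl ?sqr_ge0 // ltr_pwDl ?sqr_ge0.
  rewrite ler_norml -mulN1r -log_meanZ //; apply/andP; split.
    apply: le_log_mean => //; first by apply: bmeasM => //; exact: bmeas_cst.
    by move=> x _; have := remN x; rewrite ler_norml mulN1r => /andP[].
  apply: le_log_mean => // x _.
  exact: le_trans (ler_norm _) (remN x).
apply: cvg_lim => //; apply/cvgrPdist_le => e e0.
have /cvgrPdist_le/(_ e e0) := @powR_cvg0 R s s_gt0.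
rewrite near_withinE => -[d /= d0 dP].
near=> n; rewrite serE opprB addrC subrK (le_trans (remB n)) //.
have n0 : 0 < (n.*2.+1)%:R^-1 :> R by rewrite invr_gt0.
have := dP (n.*2.+1)%:R^-1; rewrite sub0r normrN ger0_norm ?powR_ge0 // => /(_ _ n0).
apply; rewrite /ball_ /= sub0r normrN gtr0_norm //.
apply: (@le_lt_trans _ _ (n.+1%:R^-1)).
  by rewrite lef_pV2 ?posrE // ler_nat ltnS -addnn leq_addr.
by near: n; exact: (near_infty_natSinv_lt (PosNum d0)).
Unshelve. all: by end_near. Qed.

End beta.


(** * The reflection exchanging x and sqrt (1 - x ^ 2) *)

Section pairing.
Variable R : realType.

(** With [l = x / y], the number [1 - x * y] is the convex combination with
    weight [l] of [x ^ 2 = 1 - y ^ 2] and [1]. Concavity of [ln] gives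
    [l * ln (x ^ 2) <= ln (1 - x * y)], and [1 - x * y <= 1 - x ^ 2 = y ^ 2]. *)
Lemma mul_ln_swap (x y : R) : 0 < x -> x < y -> x ^+ 2 + y ^+ 2 = 1 ->
  y * - ln y <= x * - ln x.
Proof.
move=> x0 xy xy1; have y0 := lt_trans x0 xy.
have l0 : 0 <= x / y by rewrite divr_ge0 // ltW.
have l1 : x / y <= 1 by rewrite ler_pdivrMr // mul1r ltW.
have x20 : 0 < x ^+ 2 by rewrite exprn_gt0.
have := @concave_ln _ (Itv01 l0 l1) _ _ x20 ltr01.
rewrite !convRE /= ln1 mulr0 addr0 mulr1 => qle.
have qE : x / y * x ^+ 2 + (1 - x / y) = 1 - x * y.
  have -> : x ^+ 2 = 1 - y ^+ 2 by rewrite -xy1 addrK.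
  by field; exact: lt0r_neq0.
have xxy : x * x < x * y by rewrite ltr_pM2l.
have {}qle : x / y * ln (x ^+ 2) <= ln (1 - x * y) by rewrite -qE; exact: qle.
have : x / y * ln (x ^+ 2) <= ln (y ^+ 2).
  have yxy : x * y < y * y by rewrite ltr_pM2r.
  apply: (le_trans qle); rewrite ler_ln ?posrE ?exprn_gt0 //; first nra.
  by rewrite subr_gt0; nra.
rewrite !lnXn // mulrAC ler_pdivrMr // !mulr2n => h; nra.
Qed.

(** This is where [2 <= s] is used: the weight is [- ln x] times the power
    [s - 2] of [- ln x], which decreases in [x]. *)
Lemma log_weight_swap (s x y : R) : 2 <= s -> 0 < x -> x < y ->
  x ^+ 2 + y ^+ 2 = 1 -> log_weight s y * y <= log_weight s x * x.
Proof.
move=> s2 x0 xy xy1; have y0 := lt_trans x0 xy.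
have y1 : y < 1.
  by rewrite -(@ltr_pXn2r _ 2) ?nnegrE ?(ltW y0) // expr1n -xy1 ltrDr exprn_gt0.
have Ly : 0 < - ln y by rewrite oppr_gt0 ln_lt0 // y0.
have Lxy : - ln y < - ln x by rewrite ltrN2 ltr_ln ?posrE.
have wE u : 0 < - ln u -> log_weight s u = (- ln u) `^ (s - 2) * - ln u.
  move=> u0; rewrite /log_weight -[X in _ = _ * X](powRr1 (ltW u0)) -powRD.
    by congr (_ `^ _); ring.
  by rewrite (gt_eqF u0) implybT.
rewrite (wE _ Ly) (wE _ (lt_trans Ly Lxy)) -!mulrA; apply: ler_pM.
- exact: powR_ge0.
- by rewrite mulr_ge0 ?(ltW Ly) ?(ltW y0).
- by rewrite ge0_ler_powR ?subr_ge0 ?nnegrE ?(ltW Ly) ?(ltW Lxy) ?(ltW (lt_trans Ly Lxy)).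
- by rewrite [- ln y * _]mulrC [- ln x * _]mulrC mul_ln_swap.
Qed.

End pairing.

Section reflection.
Variables (R : realType) (s : R).
Hypothesis s_ge2 : 2 <= s.
Notation mu := (@lebesgue_measure R).
Notation unit := (`]0%R, 1%R[%classic : set R).
Let c : R := Num.sqrt 2^-1.

Let s_gt0 : 0 < s. Proof. exact: lt_le_trans s_ge2. Qed.
Let c_gt0 : 0 < c. Proof. by rewrite sqrtr_gt0 invr_gt0. Qed.
Let c_sqr : c ^+ 2 = 2^-1. Proof. by rewrite sqr_sqrtr // invr_ge0. Qed.
Let c_lt1 : c < 1.
Proof. rewrite -(@ltr_pXn2r _ 2) ?nnegrE ?(ltW c_gt0) // c_sqr; lra. Qed.

Lemma itv_0c_bigcup : `]0, c[%classic =
  \bigcup_n `[c / n.+3%:R, c - c / n.+3%:R]%classic.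
Proof.
apply/seteqP; split=> [x /=|x [n _ /=]]; rewrite !in_itv /=.
  move=> /andP[x0 xc]; have cx : 0 < c - x by rewrite subr_gt0.
  pose y := Num.max (c / x) (c / (c - x)).
  have [n yn] : exists n : nat, y <= n%:R.
    exists (Num.bound y); apply: ltW; apply: le_lt_trans (archi_boundP _).
      by [].
    by rewrite /y le_max divr_ge0 // ltW.
  have {}yn : y <= n.+3%:R.
    by rewrite (le_trans yn) // ler_nat -addn3 leq_addr.
  exists n => //=; rewrite in_itv /= lerBrDl -lerBrDr.
  have n0 : 0 < n.+3%:R :> R by rewrite ltr0n.
  rewrite !ler_pdivrMr //; apply/andP; split; rewrite -ler_pdivrMl // mulrC.
    by rewrite (le_trans _ yn) // le_max lexx.
  by rewrite (le_trans _ yn) // le_max lexx orbT.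
case/andP => nx xn; rewrite (lt_le_trans _ nx) ?divr_gt0 ?ltr0n //=.
by rewrite (le_lt_trans xn) // gtrBl divr_gt0 ?ltr0n.
Qed.

Let refl (x : R) : R := Num.sqrt (1 - x ^+ 2).
Let drefl (x : R) : R := - x / refl x.

Lemma itv0c_sqr x : 0 < x < c -> 2^-1 < 1 - x ^+ 2 < 1.
Proof.
move=> /andP[x0 xc].
have : x ^+ 2 < c ^+ 2 by rewrite ltr_pXn2r ?nnegrE ?ltW // (lt_trans x0).
rewrite c_sqr => h; have : 0 < x ^+ 2 by rewrite exprn_gt0.
by lra.
Qed.

Lemma reflect_sqr x : 0 < x < c -> refl x ^+ 2 = 1 - x ^+ 2.
Proof. by move=> /itv0c_sqr h; rewrite sqr_sqrtr //; lra. Qed.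

Lemma reflect_itv x : 0 < x < c -> c < refl x < 1.
Proof.
move=> xc; have F0 : 0 <= refl x by exact: sqrtr_ge0.
rewrite -(@ltr_pXn2r _ 2) ?nnegrE ?(ltW c_gt0) //.
rewrite -[refl x < 1](@ltr_pXn2r _ 2) ?nnegrE // reflect_sqr // c_sqr expr1n.
exact: itv0c_sqr.
Qed.

Lemma is_derive_reflect (x : R) : 0 < x < c -> is_derive x 1 refl (drefl x).
Proof.
move=> xc; have x1 : 0 < 1 - x ^+ 2 by have := itv0c_sqr xc; lra.
have -> : drefl x = (2 * Num.sqrt (1 - x ^+ 2))^-1 * (- (2 * x)).
  by rewrite /drefl /refl; field; rewrite gt_eqF // sqrtr_gt0.
apply: (@is_derive1_comp R Num.sqrt (fun x => 1 - x ^+ 2)).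
  exact: is_derive1_sqrt.
by apply: is_derive_eq; rewrite /GRing.scale /=; ring.
Qed.

Lemma reflect_gt0 x : 0 < x < c -> 0 < refl x.
Proof. by move=> /reflect_itv /andP[+ _]; exact: lt_trans. Qed.

Lemma continuous_reflect x : 0 < x < c -> {for x, continuous refl}.
Proof.
move=> /is_derive_reflect[d _].
exact/differentiable_continuous/derivable1_diffP.
Qed.

Lemma continuous_dreflect x : 0 < x < c -> {for x, continuous drefl}.
Proof.
move=> xc; apply: cvgM; first by apply: cvgN; exact: cvg_id.
by apply: cvgV; [rewrite gt_eqF // reflect_gt0|exact: continuous_reflect].
Qed.

(** The change of variables [y = sqrt (1 - x ^ 2)], which exchanges the parts of
    (0, 1) on either side of [sqrt (1 / 2)]. *)
Lemma ge0_integral_swap (G : R -> R) :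
  (forall y, c < y < 1 -> {for y, continuous G}) ->
  (forall y, c < y < 1 -> 0 <= G y) ->
  (\int[mu]_(y in `]c, 1%R[) (G y)%:E =
   \int[mu]_(x in `]0%R, c[) (G (refl x) * - drefl x)%:E)%E.
Proof.
move=> cG G0.
have inD x : `]0, c[%classic x -> 0 < x < c by rewrite /= in_itv.
have -> : `]c, 1%R[%classic = refl @` `]0, c[%classic.
  apply/seteqP; split=> [y /=|_ [x /inD xc <-] /=]; rewrite in_itv /=;
    last exact: reflect_itv.
  move=> /andP[cy y1]; have y0 := lt_trans c_gt0 cy.
  have y21 : y ^+ 2 < 1 by rewrite expr_lt1 // ltW.
  have y2c : 2^-1 < y ^+ 2 by rewrite -c_sqr ltr_pXn2r ?nnegrE ?ltW.
  exists (refl y); rewrite /= ?in_itv /= /refl.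
    rewrite sqrtr_gt0 subr_gt0 y21 /c ltr_sqrt ?invr_gt0 //.
    by lra.
  rewrite sqr_sqrtr ?subr_ge0 ?(ltW y21) // opprB addrC subrK.
  by rewrite sqrtr_sqr gtr0_norm.
have n3 n : 0 < n.+3%:R :> R by rewrite ltr0n.
have cn n m : (n <= m)%N -> c / m.+3%:R <= c / n.+3%:R.
  by move=> nm; rewrite ler_pM2l // lef_pV2 ?posrE // ler_nat.
apply: (ge0_integration_by_substitution_exhaustion _ itv_0c_bigcup) => //.
- move=> n; have : c / n.+3%:R <= c / 2.
    by rewrite ler_pM2l // lef_pV2 ?posrE // ler_nat.
  by set u := c / _; lra.
- by move=> n m /cn; rewrite lerD2l lerN2.
- by move=> x /inD; exact: is_derive_reflect.
- by move=> x /inD; exact: continuous_dreflect.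
- move=> x Dx; rewrite /drefl mulNr oppr_le0 divr_ge0 ?sqrtr_ge0 //.
  by have /andP[/ltW] := inD _ Dx.
- move=> x y Dx Dy xy; have /andP[x0 _] := inD _ Dx.
  have /itv0c_sqr/andP[x2 _] := inD _ Dx.
  rewrite /refl ltr_sqrt; last by apply: lt_trans x2; rewrite invr_gt0.
  rewrite ltrD2l ltrN2 ltr_pXn2r ?nnegrE ?(ltW x0) //.
  by rewrite ltW // (lt_trans x0).
- by move=> x /inD /reflect_itv; exact: cG.
- by move=> x /inD /reflect_itv; exact: G0.
Qed.

(** The value [1 - 2 * x ^ 2] is positive exactly when [x < sqrt (1 / 2)]. On
    the other part [phi] is at least minus its value at the reflected point, and
    carrying that lower bound over by [ge0_integral_swap] turns the weight into
    one that [log_weight_swap] compares with the weight on the first part. *)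
Lemma log_mean_pairing (phi : R -> R) :
  bmeas (fun x => phi (1 - 2 * x ^+ 2)) ->
  (forall z, 0 < z < 1 -> {for z, continuous phi}) ->
  (forall z, 0 < z < 1 -> 0 <= phi z) ->
  (forall z, 0 < z < 1 -> - phi z <= phi (- z)) ->
  0 <= log_mean s (fun x => x ^+ 2 * phi (1 - 2 * x ^+ 2)).
Proof.
move=> bphi cphi phi0 phiN.
rewrite /log_mean mulr_ge0 ?invr_ge0 ?(ltW (Gamma_gt0 s_gt0)) //.
set h := fun x => log_weight s x * (x ^+ 2 * phi (1 - 2 * x ^+ 2)).
(* On the second half, [- k] is the lower bound for [h] given by [phiN]. *)
pose k y := log_weight s y * (y ^+ 2 * phi (2 * y ^+ 2 - 1)).
have ih : mu.-integrable unit (EFin \o h).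
  apply: integrable_log_weightM => //; apply: bmeasM => //.
  by apply: bmeasX; exact: bmeas_id.
have sub0 : `]0, c[%classic `<=` unit.
  by apply: subset_itvl; rewrite bnd_simp ltW.
have sub1 : `]c, 1[%classic `<=` unit.
  by apply: subset_itvr; rewrite bnd_simp ltW.
have sq_c x : 0 < x < c -> 0 < 1 - 2 * x ^+ 2 < 1.
  by move=> /itv0c_sqr; lra.
have sq_1 y : c < y < 1 -> 0 < 2 * y ^+ 2 - 1 < 1.
  move=> /andP[cy y1]; have y0 := lt_trans c_gt0 cy.
  have : y ^+ 2 < 1 by rewrite expr_lt1 // ltW.
  have : 2^-1 < y ^+ 2 by rewrite -c_sqr ltr_pXn2r ?nnegrE ?ltW.
  by lra.
have k0 y : c < y < 1 -> 0 <= k y.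
  move=> /sq_1 /phi0 p0; rewrite mulr_ge0 ?log_weight_ge0 //.
  by rewrite mulr_ge0 ?sqr_ge0.
have ck y : c < y < 1 -> {for y, continuous k}.
  move=> yc; have yu : unit y by apply: sub1; rewrite /= in_itv.
  apply: cvgM; first exact: continuous_log_weight.
  apply: cvgM; first exact: exprn_continuous.
  have : {for y, continuous (phi \o (fun y => 2 * y ^+ 2 - 1))}; last exact.
  apply: continuous_comp.
    apply: cvgB; last exact: cvg_cst.
    by apply: cvgM; [exact: cvg_cst|exact: exprn_continuous].
  by apply: cphi; exact: sq_1.
have kh : (\int[mu]_(y in `]c, 1%R[) (k y)%:E <= \int[mu]_(x in `]0%R, c[) (h x)%:E)%E.
  rewrite ge0_integral_swap //; apply: ge0_le_integral => //.
  - move=> x; rewrite /= in_itv /= => /[dup] xc /reflect_itv /k0 kF.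
    rewrite lee_fin mulr_ge0 // /drefl mulNr opprK divr_ge0 ?sqrtr_ge0 //.
    by case/andP: xc => /ltW.
  - apply/measurable_EFinP; apply: open_continuous_measurable_fun => // x.
    rewrite inE /= in_itv /= => xc; apply: cvgM.
      apply: (@continuous_comp _ _ _ refl k); first exact: continuous_reflect.
      by apply: ck; exact: reflect_itv.
    by apply: cvgN; exact: continuous_dreflect.
  - have /integrableP[mh _] := ih.
    by apply: (measurable_funS _ sub0 mh).
  - move=> x; rewrite /= in_itv /= => xc; rewrite lee_fin.
    have /andP[cF F1] := reflect_itv xc; case/andP: (xc) => x0 x1.
    have Fx0 : 0 < refl x by exact: lt_trans cF.
    have Fsq := reflect_sqr xc.
    have -> : k (refl x) * - drefl x =
        (log_weight s (refl x) * refl x) * (x * phi (1 - 2 * x ^+ 2)).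
      rewrite /k Fsq; have -> : 2 * (1 - x ^+ 2) - 1 = 1 - 2 * x ^+ 2 by ring.
      by rewrite /drefl -Fsq; field; rewrite gt_eqF.
    have -> : h x = (log_weight s x * x) * (x * phi (1 - 2 * x ^+ 2)).
      by rewrite /h; ring.
    rewrite ler_wpM2r //; first by rewrite mulr_ge0 ?(ltW x0) // phi0 // sq_c.
    apply: log_weight_swap => //; first exact: lt_trans cF.
    by rewrite Fsq; ring.
have i0 : mu.-integrable `]0, c[ (EFin \o h) by exact: integrableS ih.
have i1 : mu.-integrable `]c, 1[ (EFin \o h) by exact: integrableS ih.
have ik : mu.-integrable `]c, 1[ (EFin \o k).
  apply/integrableP; split.
    apply/measurable_EFinP; apply: open_continuous_measurable_fun => // y.
    by rewrite inE /= in_itv; exact: ck.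
  apply: (@le_lt_trans _ _ (\int[mu]_(y in `]c, 1%R[) (k y)%:E)%E).
    rewrite le_eqVlt; apply/orP; left; apply/eqP; apply: eq_integral => y.
    by rewrite inE /= in_itv /= => /k0 ky; rewrite ger0_norm.
  by apply: (le_lt_trans kh); rewrite ltey_eq (integrable_fin_num _ i0).
have -> : \int[mu]_(x in unit) h x =
    \int[mu]_(x in `]0, c[) h x + \int[mu]_(x in `]c, 1[) h x.
  rewrite -(@Rintegral_itvB _ h _ _ c ih) ?bnd_simp // ?ltW //.
  by rewrite -(Rintegral_itv_bndo_bndc i0) addrC subrK.
have hk : 0 <= \int[mu]_(x in `]c, 1[) (h x + k x).
  apply: Rintegral_ge0 => y; rewrite /= in_itv /= => yc.
  rewrite /h /k -mulrDr mulr_ge0 ?log_weight_ge0 // -mulrDr.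
  rewrite mulr_ge0 ?sqr_ge0 // -lerBlDr sub0r.
  by have := phiN _ (sq_1 _ yc); rewrite opprB.
rewrite RintegralD // in hk; apply: (le_trans hk); rewrite addrC lerD2r.
by rewrite /Rintegral fine_le //; exact: integrable_fin_num.
Qed.

End reflection.

(** * Convolutions and the renewal equation *)

Definition conv (K : pzRingType) (a b : nat -> K) (n : nat) : K :=
  \sum_(k < n.+1) a k * b (n - k)%N.

Definition deriv_coef (K : pzRingType) (a : nat -> K) (k : nat) : K :=
  k.+1%:R * a k.+1.

Lemma convC (K : comNzRingType) (a b : nat -> K) n : conv a b n = conv b a n.
Proof.
rewrite /conv (reindex_inj rev_ord_inj) /=; apply: eq_bigr => k _.
by rewrite subSS mulrC subKn // -ltnS.
Qed.

Lemma conv_delta1 (K : pzRingType) (a : nat -> K) n :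
  conv (fun k => (k == 1%N)%:R) a n.+1 = a n.
Proof.
rewrite /conv !big_ord_recl /= mul0r add0r mul1r subSS subn0.
by rewrite big1 ?addr0 // => i _; rewrite mul0r.
Qed.

Lemma deriv_coef_conv (K : comNzRingType) (a b : nat -> K) n :
  deriv_coef (conv a b) n =
  conv a (deriv_coef b) n + conv b (deriv_coef a) n.
Proof.
rewrite [conv b _ n]convC /deriv_coef /conv mulr_sumr.
transitivity (\sum_(k < n.+2) (k%:R * a k * b (n.+1 - k)%N +
    a k * ((n.+1 - k)%:R * b (n.+1 - k)%N))).
  apply: eq_bigr => k _.
  rewrite [X in X%:R * _](_ : n.+1 = k + (n.+1 - k))%N; last first.
    by rewrite subnKC // -ltnS.
  rewrite natrD; set u := (_ - _)%N; ring.
rewrite big_split /= addrC; congr (_ + _).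
  rewrite big_ord_recr /= subnn mul0r mulr0 addr0.
  by apply: eq_bigr => k _; rewrite subSn // -ltnS.
by rewrite big_ord_recl /= !mul0r add0r; apply: eq_bigr => k _.
Qed.

(** The neutral element of the convolution: the coefficients of the constant
    power series [1]. *)
Definition unit_coef (K : pzRingType) (n : nat) : K := (n == 0%N)%:R.

Definition conv_pow (K : pzRingType) (a : nat -> K) (r : nat) : nat -> K :=
  iter r (conv a) (unit_coef K).

(** The hypothesis [p 0 = 0] removes the last term of the convolution, so the
    equation expresses each coefficient by the previous ones. The bound [n]
    lets one compare with a jet that is known only to finite order. *)
Lemma renewal_uniq (K : comNzRingType) (p q b : nat -> K) n : p 0%N = 0 ->
  (forall k, q k = unit_coef K k + conv q p k) ->
  (forall k, (k <= n)%N -> b k = unit_coef K k + conv b p k) ->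
  forall k, (k <= n)%N -> b k = q k.
Proof.
move=> p0 qE bE; elim/ltn_ind => k IH kn.
rewrite bE // qE; congr (_ + _); rewrite /conv !big_ord_recr /= subnn p0 !mulr0.
congr (_ + _); apply: eq_bigr => i _.
by rewrite IH // (leq_trans (ltnW (ltn_ord i))).
Qed.

(** The list of the first [n + 1] coefficients of [1 / (1 - p)]; each new
    coefficient uses all the previous ones. *)
Fixpoint renewal_seq (K : pzRingType) (p : nat -> K) (n : nat) : seq K :=
  if n is m.+1 then
    let q := renewal_seq p m in
    rcons q (\sum_(k < n) q`_k * p (n - k)%N)
  else [:: 1].

Lemma size_renewal_seq (K : pzRingType) (p : nat -> K) n :
  size (renewal_seq p n) = n.+1.
Proof. by elim: n => //= n IH; rewrite size_rcons IH. Qed.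

Lemma nth_renewal_seq (K : pzRingType) (p : nat -> K) n k : (k <= n)%N ->
  (renewal_seq p n)`_k = (renewal_seq p k)`_k.
Proof.
elim: n => [|n IH]; first by rewrite leqn0 => /eqP ->.
rewrite leq_eqVlt => /predU1P[->//|]; rewrite ltnS => kn.
by rewrite /= nth_rcons size_renewal_seq ltnS kn IH.
Qed.

Lemma renewal_ex (K : pzRingType) (p : nat -> K) : p 0%N = 0 ->
  exists q, forall k, q k = unit_coef K k + conv q p k.
Proof.
move=> p0; exists (fun k => (renewal_seq p k)`_k) => -[|n].
  by rewrite /conv big_ord1 /= p0 mulr0 addr0.
rewrite add0r /conv big_ord_recr /= subnn p0 mulr0 addr0.
rewrite nth_rcons size_renewal_seq ltnn eqxx.
by apply: eq_bigr => k _; rewrite nth_renewal_seq // -ltnS.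
Qed.

Lemma conv_rmorph (K L : pzRingType) (f : {rmorphism K -> L}) (a b : nat -> K) n :
  conv (f \o a) (f \o b) n = f (conv a b n).
Proof. by rewrite /conv rmorph_sum; apply: eq_bigr => k _; rewrite rmorphM. Qed.

Lemma conv_pow_rmorph (K L : pzRingType) (f : {rmorphism K -> L}) (a : nat -> K) r n :
  conv_pow (f \o a) r n = f (conv_pow a r n).
Proof.
elim: r n => [|r IH] n; first by rewrite /= /unit_coef rmorph_nat.
rewrite /= -/(conv_pow _ r) -conv_rmorph; apply: eq_bigr => k _.
by rewrite IH.
Qed.


(** * Power series with positive increasing tails *)

Lemma conv_trunc (K : comNzRingType) (a b : nat -> K) w N :
  \sum_(k < N) a k * w ^+ k * (\sum_(j < N - k) b j * w ^+ j) =
  \sum_(n < N) conv a b n * w ^+ n.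
Proof.
elim: N => [|N IH]; first by rewrite !big_ord0.
rewrite [RHS]big_ord_recr /= -IH big_ord_recr /= subSnn.
rewrite [X in _ + X = _](_ : _ = a N * w ^+ N * b 0%N); last first.
  by rewrite big_ord1 expr0 mulr1.
rewrite /conv big_ord_recr /= subnn mulrDl addrA; congr (_ + _); last by ring.
rewrite mulr_suml -big_split /=; apply: eq_bigr => k _.
have kN : (k <= N)%N by exact: ltnW.
rewrite subSn // big_ord_recr /= mulrDr; congr (_ + _).
have -> : w ^+ N = w ^+ k * w ^+ (N - k) by rewrite -exprD subnKC.
by ring.
Qed.

Section tails.
Variable R : realFieldType.
Implicit Types (f g : R -> R) (a b p q : nat -> R).

(** The tails are given existentially, instead of by division by [w ^ N], so
    that their monotonicity also holds from the point [0] on. *)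
Definition pos_tails f a := (forall k, 0 <= a k) /\
  exists T : nat -> R -> R, forall N w, 0 <= w < 1 ->
    [/\ 0 < T N w, f w = \sum_(k < N) a k * w ^+ k + w ^+ N * T N w &
        forall w', w <= w' < 1 -> T N w <= T N w'].

(** The tail of order [N] of a product is the second factor times the tail of
    the first one, plus a nonnegative combination of tails of the second factor:
    [g * S N + sum_(k < N) a k * T (N - k)]. *)
Lemma pos_tailsM f g a b : pos_tails f a -> pos_tails g b ->
  pos_tails (fun w => f w * g w) (conv a b).
Proof.
move=> [a0 [S HS]] [b0 [T HT]]; split=> [k|].
  by apply: sumr_ge0 => i _; exact: mulr_ge0.
have gT w : 0 <= w < 1 -> g w = T 0%N w.
  by case/(HT 0%N) => _ -> _; rewrite big_ord0 expr0 mul1r add0r.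
exists (fun N w => g w * S N w + \sum_(k < N) a k * T (N - k)%N w) => N w w01.
have [S0 fE Smono] := HS N w w01.
have [g0 _ gmono] := HT 0%N w w01.
split.
- rewrite ltr_wpDr ?mulr_gt0 ?gT // sumr_ge0 // => k _.
  by rewrite mulr_ge0 //; case: (HT (N - k)%N w w01) => /ltW.
- rewrite {1}fE mulrDl mulr_suml.
  have -> : \sum_(k < N) a k * w ^+ k * g w =
      \sum_(k < N) (a k * w ^+ k * (\sum_(j < N - k) b j * w ^+ j)
        + w ^+ N * (a k * T (N - k)%N w)).
    apply: eq_bigr => k _; have [_ -> _] := HT (N - k)%N w w01.
    have kN : (k <= N)%N by exact: ltnW.
    rewrite mulrDr; congr (_ + _).
    by rewrite -[X in w ^+ X * (_ * _)](subnKC kN) exprD; ring.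
  by rewrite big_split /= conv_trunc -mulr_sumr; ring.
- move=> w' /andP[ww' w'1].
  have w'01 : 0 <= w' < 1 by case/andP: w01 => w0 _; rewrite (le_trans w0).
  apply: lerD.
    apply: ler_pM; rewrite ?gT ?(ltW g0) ?(ltW S0) //.
      by rewrite gmono ?ww' ?w'1.
    by rewrite Smono ?ww' ?w'1.
  apply: ler_sum => k _; rewrite ler_wpM2l //.
  by case: (HT (N - k)%N w w01) => _ _; apply; rewrite ww' w'1.
Qed.

(** The coefficient of index [n + 1] is at least [q n * p 1]. *)
Lemma renewal_gt0 p q : p 0%N = 0 -> (forall k, 0 <= p k) -> 0 < p 1%N ->
  (forall k, q k = unit_coef R k + conv q p k) -> forall k, 0 < q k.
Proof.
move=> p0 p_ge0 p1 qE; elim/ltn_ind => -[|n] IH.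
  by rewrite qE /conv big_ord1 p0 mulr0 addr0 ltr01.
rewrite qE add0r /conv big_ord_recr /= subnn p0 mulr0 addr0.
rewrite big_ord_recr /= subSnn ltr_wpDl ?mulr_gt0 ?IH //.
apply: sumr_ge0 => k _; rewrite mulr_ge0 // ltW // IH //.
by rewrite (ltn_trans (ltn_ord k)).
Qed.

(** Multiplying the expansion of [1 / (1 - P)] by [1 - P] shows that its tail of
    order [M + 1] is [(1 - P)^-1 * sum_(k <= M) q k * T (M - k)], with [T j] the
    tail of [P] of order [j + 1]; all the factors increase. *)
Lemma pos_tails_geometric (P : R -> R) p q (T : nat -> R -> R) :
  p 0%N = 0 -> (forall k, 0 <= p k) -> 0 < p 1%N ->
  (forall k, q k = unit_coef R k + conv q p k) ->
  (forall w, 0 <= w < 1 -> P w < 1) ->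
  (forall w, 0 <= w < 1 -> 0 < T 0%N w) ->
  (forall N w, 0 <= w < 1 ->
    [/\ 0 <= T N w, P w = \sum_(k < N.+1) p k * w ^+ k + w ^+ N.+1 * T N w &
        forall w', w <= w' < 1 -> T N w <= T N w']) ->
  pos_tails (fun w => (1 - P w)^-1) q.
Proof.
move=> p0 p_ge0 p1 qE P1 T0 HT.
have q0 := renewal_gt0 p0 p_ge0 p1 qE.
split=> [k|]; first exact: ltW.
have Pmono w w' : 0 <= w < 1 -> w <= w' < 1 -> P w <= P w'.
  move=> w01 ww'; have [_ -> _] := HT 0%N w w01.
  case/andP: (w01) (ww') => w0 _ /andP[ww w'1].
  have w'01 : 0 <= w' < 1 by rewrite (le_trans w0).
  have [_ -> _] := HT 0%N w' w'01.
  rewrite !big_ord1 p0 !mul0r !add0r !expr1 ler_pM ?(ltW (T0 _ _)) //.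
  by case: (HT 0%N w w01) => _ _; apply.
have Vmono w w' : 0 <= w < 1 -> w <= w' < 1 -> (1 - P w)^-1 <= (1 - P w')^-1.
  move=> w01 ww'; have w'01 : 0 <= w' < 1.
    by case/andP: w01 ww' => w0 _ /andP[ww ->]; rewrite (le_trans w0).
  by rewrite lef_pV2 ?posrE ?subr_gt0 ?P1 // lerD2l lerN2 Pmono.
exists (fun N w => if N is M.+1
  then (1 - P w)^-1 * \sum_(k < M.+1) q k * T (M - k)%N w else (1 - P w)^-1).
move=> [|N] w w01.
  split; last by move=> w' ww'; exact: Vmono.
    by rewrite invr_gt0 subr_gt0 P1.
  by rewrite big_ord0 expr0 mul1r add0r.
have V0 : 0 < (1 - P w)^-1 by rewrite invr_gt0 subr_gt0 P1.
have sum0 : 0 < \sum_(k < N.+1) q k * T (N - k)%N w.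
  rewrite big_ord_recr /= subnn ltr_wpDl ?mulr_gt0 ?T0 //.
  apply: sumr_ge0 => k _; rewrite mulr_ge0 ?(ltW (q0 _)) //.
  by case: (HT (N - k)%N w w01).
split.
- by rewrite mulr_gt0.
- have P1n : 1 - P w != 0 by rewrite gt_eqF // subr_gt0 P1.
  apply: (mulfI P1n); rewrite mulfV // mulrDr.
  rewrite [X in _ + X]mulrCA mulrA mulrA -[_ * _ / _]mulrA.
  rewrite mulrA mulfK //.
  have -> : w ^+ N.+1 * \sum_(k < N.+1) q k * T (N - k)%N w =
      \sum_(k < N.+1) q k * w ^+ k * P w -
      \sum_(k < N.+1) q k * w ^+ k * (\sum_(j < N.+1 - k) p j * w ^+ j).
    rewrite mulr_sumr -sumrB; apply: eq_bigr => k _.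
    have [_ -> _] := HT (N - k)%N w w01.
    have kN : (k <= N)%N by rewrite -ltnS.
    have -> : w ^+ N.+1 = w ^+ k * w ^+ (N - k).+1 by rewrite -exprD addnS subnKC.
    by rewrite subSn //; ring.
  rewrite conv_trunc -mulr_suml.
  under [X in _ + (_ - X)]eq_bigr => k _.
    have -> : conv q p k = q k - unit_coef R k.
      by apply/eqP; rewrite eq_sym subr_eq addrC -qE.
    rewrite mulrBl; over.
  have unitE : \sum_(k < N.+1) unit_coef R k * w ^+ k = 1.
    rewrite big_ord_recl /unit_coef /= expr0 mulr1 big1 ?addr0 // => i _.
    by rewrite mul0r.
  by rewrite sumrB unitE; ring.
- move=> w' ww'; apply: ler_pM; rewrite ?(ltW V0) ?(ltW sum0) ?Vmono //.
  apply: ler_sum => k _; rewrite ler_wpM2l ?(ltW (q0 _)) //.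
  by case: (HT (N - k)%N w w01) => _ _; apply.
Qed.

Lemma pos_tails_conv_pow f a r : pos_tails f a ->
  pos_tails (fun w => f w ^+ r.+1) (conv_pow a r.+1).
Proof.
move=> fa; elim: r => [|r IH].
  have -> : conv_pow a 1 = a.
    apply/funext => n; rewrite /= /conv big_ord_recr /= subnn mulr1.
    rewrite big1 ?add0r // => i _.
    by rewrite /unit_coef subn_eq0 leqNgt ltn_ord mulr0.
  by under eq_fun do rewrite expr1.
under eq_fun do rewrite exprS.
exact: pos_tailsM.
Qed.

(** The remainder is [w ^ N * T N w], which is at most
    [(w / rho) ^ N * (rho ^ N * T N rho)] since [T N] increases, and
    [rho ^ N * T N rho <= f rho] since the coefficients are nonnegative. *)
Lemma pos_tails_remainder f a N w rho : pos_tails f a ->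
  0 < w -> w < rho -> rho < 1 ->
  0 < f w - \sum_(k < N) a k * w ^+ k <= (w / rho) ^+ N * f rho.
Proof.
move=> [a0 [T HT]] w0 wrho rho1.
have rho0 : 0 < rho := lt_trans w0 wrho.
have w01 : 0 <= w < 1 by rewrite (ltW w0) (lt_trans wrho).
have rho01 : 0 <= rho < 1 by rewrite (ltW rho0).
have [Tw -> mono] := HT N w w01.
have [_ -> _] := HT N rho rho01.
rewrite addrC addKr mulr_gt0 ?exprn_gt0 //= expr_div_n -mulrA.
rewrite ler_pM2l ?exprn_gt0 // mulrC ler_pdivlMr ?exprn_gt0 //.
rewrite mulrC ler_wpDl //.
  by apply: sumr_ge0 => k _; rewrite mulr_ge0 // exprn_ge0 // ltW.
by rewrite ler_pM2l ?exprn_gt0 // mono // (ltW wrho).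
Qed.

End tails.

(** * Jets of complex functions at the origin *)

Section jets.
Variable K : numFieldType.
Implicit Types (f g : K^o -> K^o) (a b : nat -> K).

(** The sequence [a] holds the normalized Taylor coefficients of [f] at [0], up to
    order [n]. Each derivative is required on a neighbourhood of [0], which makes
    the notion depend on the germ of [f] only. *)
Fixpoint has_jet (n : nat) (f : K^o -> K^o) (a : nat -> K) : Prop :=
  f 0 = a 0%N /\
  if n is m.+1 then exists2 g : K^o -> K^o,
    \forall w \near (0 : K^o), is_derive w (1 : K^o) f (g w) &
    has_jet m g (deriv_coef a)
  else True.

Lemma has_jet0 n f a : has_jet n f a -> f 0 = a 0%N.
Proof. by case: n => [|n] []. Qed.

Lemma has_jetS n f a : has_jet n.+1 f a -> has_jet n f a.
Proof.
elim: n f a => [f a [fa] //|n IH f a [fa [g dg jg]]].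
by split=> //; exists g => //; exact: IH.
Qed.

Lemma eq_has_jet n f a b :
  (forall k, (k <= n)%N -> a k = b k) -> has_jet n f a -> has_jet n f b.
Proof.
elim: n f a b => [|n IH] f a b ab /= [fa H]; first by rewrite -ab.
split; first by rewrite -ab.
case: H => g dg jg; exists g => //; apply: IH jg => k kn.
by rewrite /deriv_coef ab.
Qed.

Lemma near_eq_has_jet n f g a : (\forall w \near (0 : K^o), f w = g w) ->
  has_jet n f a -> has_jet n g a.
Proof.
case: n => [|n] fg /= [fa H]; first by rewrite -(nbhs_singleton fg).
split; first by rewrite -(nbhs_singleton fg).
case: H => h dh jh; exists h => //.
near=> w.
have dfw : is_derive w (1 : K^o) f (h w) by near: w.
apply: near_eq_is_derive dfw.
by near: w; exact: nbhs_interior fg.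
Unshelve. all: by end_near. Qed.

Lemma has_jet_derive1n n f a : has_jet n f a ->
  derive1n n f 0 = n`!%:R * a n.
Proof.
elim: n f a => [f a [fa _]|n IH f a [fa [g dg jg]]].
  by rewrite /derive1n /= fact0 mul1r.
rewrite derive1Sn (IH _ (deriv_coef a)).
  by rewrite /deriv_coef mulrA -natrM mulnC -factS.
apply: near_eq_has_jet jg; near=> w.
have dfw : is_derive w (1 : K^o) f (g w) by near: w.
by rewrite derive1E; case: dfw.
Unshelve. all: by end_near. Qed.

Lemma has_jet_cst n (c : K) :
  has_jet n (fun _ => c) (fun k => if k is 0 then c else 0).
Proof.
elim: n c => [//|n IH c]; split=> //; exists (fun _ => 0).
  by near=> w; exact: is_derive_cst.
by apply: eq_has_jet (IH 0) => k _; rewrite /deriv_coef mulr0; case: k.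
Unshelve. all: by end_near. Qed.

Lemma has_jet_id n : has_jet n (fun w => w) (fun k => (k == 1%N)%:R).
Proof.
case: n => [//|n]; split=> //; exists (fun _ => 1).
  by near=> w; exact: is_derive_id.
apply: eq_has_jet (has_jet_cst n 1) => k _.
by rewrite /deriv_coef eqSS; case: k => [|k]; rewrite ?mulr1 ?mulr0.
Unshelve. all: by end_near. Qed.

Lemma has_jetD n f g a b : has_jet n f a -> has_jet n g b ->
  has_jet n (fun w => f w + g w) (fun k => a k + b k).
Proof.
elim: n f g a b => [|n IH] f g a b [fa H] [gb H'].
  by split; rewrite // fa gb.
split; first by rewrite fa gb.
case: H H' => f' df jf [g' dg jg]; exists (fun w => f' w + g' w).
  by near=> w; apply: is_deriveD; near: w.
by apply: eq_has_jet (IH _ _ _ _ jf jg) => k _; rewrite /deriv_coef mulrDr.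
Unshelve. all: by end_near. Qed.

Lemma has_jetM n f g a b : has_jet n f a -> has_jet n g b ->
  has_jet n (fun w => f w * g w) (conv a b).
Proof.
elim: n f g a b => [|n IH] f g a b jf jg.
  by split; rewrite // /conv big_ord1 (has_jet0 jf) (has_jet0 jg).
split; first by rewrite /conv big_ord1 (has_jet0 jf) (has_jet0 jg).
have := has_jetS jf; have := has_jetS jg.
case: jf jg => fa [f' df jf] [gb [g' dg jg]] jg0 jf0.
exists (fun w => f w * g' w + g w * f' w).
  by near=> w; apply: is_deriveM; near: w.
apply: eq_has_jet (has_jetD (IH _ _ _ _ jf0 jg) (IH _ _ _ _ jg0 jf)) => k _.
by rewrite deriv_coef_conv.
Unshelve. all: by end_near. Qed.

Lemma has_jet_neq0 n f a : f 0 != 0 -> has_jet n.+1 f a ->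
  \forall w \near (0 : K^o), f w != 0.
Proof.
move=> f0 [_ [f' df _]].
have [d0 _] : is_derive (0 : K^o) (1 : K^o) f (f' 0).
  exact: nbhs_singleton df.
have /differentiable_continuous cf := (derivable1_diffP _ _).1 d0.
by have /cvgr_neq0 := cf; exact.
Qed.

(** The derivative [- f' / f ^ 2] of the inverse is a product of functions that
    have jets of lower order. Only existence matters here: the coefficients are
    identified afterwards, from the product with [f]. *)
Lemma has_jetV n f a : f 0 != 0 -> has_jet n f a ->
  exists b, has_jet n (fun w => (f w)^-1) b.
Proof.
move=> f0; elim: n f a f0 => [|n IH] f a f0 jf.
  by exists (fun _ => (f 0)^-1).
have [b jb] := IH _ _ f0 (has_jetS jf).
have fN0 := has_jet_neq0 f0 jf.
case: jf => fa [f' df jf].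
(* The coefficients of [(f^-1) ^ 2 * f']. *)
pose d := conv (conv b b) (deriv_coef a).
exists (fun k => if k is m.+1 then - d m / m.+1%:R else (f 0)^-1).
split=> //; exists (fun w => (-1) * ((f w)^-1 * (f w)^-1 * f' w)); last first.
  apply: eq_has_jet (has_jetM (has_jet_cst n (-1)) (has_jetM (has_jetM jb jb) jf)).
  move=> k _; rewrite /deriv_coef /= mulrC divfK ?pnatr_eq0 //.
  rewrite {1}/conv big_ord_recl /= subn0 mulN1r big1 ?addr0 // => i _.
  by rewrite mul0r.
near=> w.
have fw0 : f w != 0 by near: w.
have [dfw dfE] : is_derive (w : K^o) (1 : K^o) f (f' w) by near: w.
apply: DeriveDef; first exact: derivableV.
rewrite deriveV // dfE /GRing.scale /=.
by rewrite -invfM -expr2 mulN1r mulNr.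
Unshelve. all: by end_near. Qed.

Lemma has_jet_uniq n f a b : has_jet n f a -> has_jet n f b ->
  forall k, (k <= n)%N -> a k = b k.
Proof.
move=> ja jb k kn.
have jk c : has_jet n f c -> has_jet k f c.
  rewrite -(subnKC kn); elim: (n - k)%N => [|m IH]; first by rewrite addn0.
  by rewrite addnS => /has_jetS.
have := has_jet_derive1n (jk _ ja); rewrite (has_jet_derive1n (jk _ jb)).
by move/mulfI => -> //; rewrite pnatr_eq0 -lt0n fact_gt0.
Qed.

(** The jet of the product of [f] and its inverse is the jet of [1], so the jet
    of the inverse solves the renewal equation and [renewal_uniq] applies. *)
Lemma has_jet_geometric n f p q : p 0%N = 0 ->
  (forall k, q k = unit_coef K k + conv q p k) ->
  has_jet n f (fun k => unit_coef K k - p k) -> has_jet n (fun w => (f w)^-1) q.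
Proof.
move=> p0 qE jf.
have q0 : q 0%N = 1 by rewrite qE /conv big_ord1 /= p0 mulr0 addr0.
have f0 : f 0 = 1 by rewrite (has_jet0 jf) p0 subr0.
have f0n : f 0 != 0 by rewrite f0 oner_neq0.
have [b jb] := has_jetV f0n jf.
case: n => [|n] in jf jb *; first by split; rewrite // f0 q0 invr1.
have j1 : has_jet n.+1 (fun _ => 1) (conv (fun k => unit_coef K k - p k) b).
  apply: near_eq_has_jet (has_jetM jf jb); near=> w.
  by apply: mulfV; near: w; exact: has_jet_neq0 jf.
apply: eq_has_jet jb; apply: (renewal_uniq p0 qE) => k kn.
have := has_jet_uniq j1 (has_jet_cst n.+1 1) kn.
have -> : conv (fun k => unit_coef K k - p k) b k = b k - conv p b k.
  rewrite /conv; under eq_bigr do rewrite mulrBl.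
  rewrite sumrB big_ord_recl /= subn0 mul1r big1 ?addr0 // => i _.
  by rewrite mul0r.
rewrite (convC p) => /eqP; rewrite subr_eq => /eqP ->.
by congr (_ + _); case: (k).
Unshelve. all: by end_near. Qed.

Lemma has_jet_conv_pow n f a r : has_jet n f a ->
  has_jet n (fun w => f w ^+ r) (conv_pow a r).
Proof.
move=> jf; elim: r => [|r IH].
  by apply: eq_has_jet (has_jet_cst n 1) => -[|k].
have -> : (fun w => f w ^+ r.+1) = (fun w => f w * f w ^+ r).
  by apply/funext => w; rewrite exprS.
exact: has_jetM.
Qed.

(** A remainder bounded by [C * `|h| ^ 2] is the form in which differentiation
    under the integral sign produces derivatives. *)
Lemma quadratic_is_derive (f : K^o -> K^o) (w g : K^o) (C d : K) :
  0 <= C -> 0 < d ->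
  (forall h, `|h| < d -> `|f (h + w) - f w - h * g| <= C * `|h| ^+ 2) ->
  is_derive w (1 : K^o) f g.
Proof.
move=> C0 d0 Hf.
have fg : (fun h => h^-1 *: ((f \o shift w) (h *: (1 : K^o)) - f w)) @ 0^' --> g.
  apply/cvgrPdist_le => e e0; near=> h.
  have h0 : h != 0 by near: h; exact: nbhs_dnbhs_neq.
  have hd : `|h| < d by near: h; exact: dnbhs0_lt.
  have he : `|h| <= e / (C + 1).
    by near: h; apply: dnbhs0_le; rewrite divr_gt0 // ltr_wpDl.
  have -> : g - h^-1 *: ((f \o shift w) (h *: (1 : K^o)) - f w) =
      - (h^-1 * (f (h + w) - f w - h * g)).
    rewrite /= /GRing.scale /= mulr1 [in RHS]mulrBr mulrA mulVf // mul1r.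
    by rewrite opprB.
  rewrite normrN normrM normfV ler_pdivrMl ?normr_gt0 //.
  apply: (le_trans (Hf _ hd)); rewrite expr2 mulrCA ler_wpM2l //.
  rewrite ler_pdivlMr ?ltr_wpDl // in he.
  apply: le_trans he; rewrite mulrC ler_wpM2l // lerDl //.
apply: DeriveDef; last exact: cvg_lim fg.
by apply/cvg_ex; exists g.
Unshelve. all: by end_near. Qed.

End jets.

(** * Complex-valued means *)

(** The relation between [a] and [b] is the resolvent identity satisfied by
    [a = 1 / (1 - (w + h) * z)] and [b = 1 / (1 - w * z)]. The constant is
    independent of [z], so the estimate can be integrated. *)
Lemma resolvent_powers_taylor (K : numFieldType) (m : nat) :
  exists2 C : K, 0 <= C & forall a b z h : K,
    a - b = h * z * a * b -> `|a| <= 2 -> `|b| <= 2 -> `|z| <= 1 ->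
    `|a ^+ m - b ^+ m - h * (m%:R * z * b ^+ m.+1)| <= C * `|h| ^+ 2.
Proof.
elim: m => [|m [C C0 HC]].
  by exists 0 => // a b z h _ _ _ _; rewrite !expr0 subrr !mul0r mulr0 subrr normr0.
exists (2 * C + m.+1%:R * 2 * 2 ^+ m.+2) => [|a b z h ab a2 b2 z1].
  by rewrite addr_ge0 // mulr_ge0 ?exprn_ge0 // mulr_ge0 ?ler0n.
have D0 : a - b - h * z * a * b = 0 by rewrite ab subrr.
have -> : a ^+ m.+1 - b ^+ m.+1 - h * (m.+1%:R * z * b ^+ m.+2) =
    a * (a ^+ m - b ^+ m - h * (m%:R * z * b ^+ m.+1)) +
    m.+1%:R * (h * z * b ^+ m.+1) * (h * z * a * b).
  rewrite -[RHS]addr0.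
  have <- : b ^+ m * (1 + m.+1%:R * (h * z * b)) * (a - b - h * z * a * b) = 0.
    by rewrite D0 mulr0.
  by rewrite -natr1 !exprS; ring.
apply: (le_trans (ler_normD _ _)); rewrite mulrDl; apply: lerD.
  by rewrite normrM -[leRHS]mulrA; apply: ler_pM => //; exact: HC.
have -> : m.+1%:R * (h * z * b ^+ m.+1) * (h * z * a * b) =
  m.+1%:R * a * b ^+ m.+2 * z ^+ 2 * h ^+ 2 by rewrite !exprS; ring.
rewrite normrM (normrX 2 h) ler_wpM2r ?exprn_ge0 //.
rewrite normrM (normrX 2 z) -[leRHS]mulr1; apply: ler_pM; rewrite ?exprn_ge0 //.
  rewrite normrM normrX; apply: ler_pM; rewrite ?exprn_ge0 //.
    by rewrite normrM normr_nat ler_wpM2l ?ler0n.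
  by apply: lerXn2r; rewrite ?nnegrE.
by rewrite exprn_ile1.
Qed.

Section complex_mean.
Variables (R : realType) (s : R).
Hypothesis s_gt0 : 0 < s.
Notation unit := (`]0%R, 1%R[%classic : set R).
Implicit Types f g : R -> R[i].

Definition cbmeas f := bmeas (fun x => complex.Re (f x)) /\
  bmeas (fun x => complex.Im (f x)).

Definition cmean f : R[i] :=
  log_mean s (fun x => complex.Re (f x)) +i* log_mean s (fun x => complex.Im (f x)).

Lemma cbmeas_real (phi : R -> R) : bmeas phi -> cbmeas (fun x => (phi x)%:C).
Proof. by move=> bphi; split => //; exact: bmeas_cst. Qed.

Lemma cbmeas_cst c : cbmeas (fun=> c).
Proof. by split; exact: bmeas_cst. Qed.

Lemma cbmeasD f g : cbmeas f -> cbmeas g -> cbmeas (fun x => f x + g x).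
Proof.
move=> [rf jf] [rg jg]; split.
  rewrite (_ : (fun x => _) = (fun x => complex.Re (f x) + complex.Re (g x))).
    exact: bmeasD.
  by apply/funext => x; case: (f x) (g x) => ? ? [].
rewrite (_ : (fun x => _) = (fun x => complex.Im (f x) + complex.Im (g x))).
  exact: bmeasD.
by apply/funext => x; case: (f x) (g x) => ? ? [].
Qed.

Lemma cbmeasM f g : cbmeas f -> cbmeas g -> cbmeas (fun x => f x * g x).
Proof.
move=> [rf jf] [rg jg]; split.
  rewrite (_ : (fun x => _) = (fun x => complex.Re (f x) * complex.Re (g x) -
    complex.Im (f x) * complex.Im (g x))).
    by apply: bmeasB; exact: bmeasM.
  by apply/funext => x; case: (f x) (g x) => ? ? [].
rewrite (_ : (fun x => _) = (fun x => complex.Re (f x) * complex.Im (g x) +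
    complex.Im (f x) * complex.Re (g x))).
  by apply: bmeasD; exact: bmeasM.
by apply/funext => x; case: (f x) (g x) => ? ? [].
Qed.

Lemma cbmeasX f n : cbmeas f -> cbmeas (fun x => f x ^+ n).
Proof.
move=> bf; elim: n => [|n IH]; first exact: cbmeas_cst.
by under eq_fun do rewrite exprS; exact: cbmeasM.
Qed.

Lemma cbmeasV f (d : R) : 0 < d -> (forall x, unit x -> d%:C <= `|f x|) ->
  cbmeas f -> cbmeas (fun x => (f x)^-1).
Proof.
move=> d0 df [rf jf].
pose n2 x := complex.Re (f x) ^+ 2 + complex.Im (f x) ^+ 2.
have bn : bmeas (fun x => (n2 x)^-1).
  apply: (@bmeasV _ _ (d ^+ 2)); first by rewrite exprn_gt0.
    move=> x ux; rewrite -lecR /n2 add_Re2_Im2 rmorphXn /=.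
    by apply: lerXn2r; rewrite ?nnegrE ?df // ler0c ltW.
  by apply: bmeasD; exact: bmeasX.
split.
  rewrite (_ : (fun x => _) = (fun x => complex.Re (f x) * (n2 x)^-1)).
    exact: bmeasM.
  by apply/funext => x; rewrite /n2; case: (f x).
rewrite (_ : (fun x => _) = (fun x => - (complex.Im (f x) * (n2 x)^-1))).
  by apply: bmeasN; exact: bmeasM.
by apply/funext => x; rewrite /n2; case: (f x).
Qed.

Lemma eq_cmean f g : (forall x, unit x -> f x = g x) -> cmean f = cmean g.
Proof.
by move=> fg; rewrite /cmean; congr (_ +i* _); apply: eq_log_mean => x ux;
  rewrite fg.
Qed.

Lemma cmean_real (phi : R -> R) : cmean (fun x => (phi x)%:C) = (log_mean s phi)%:C.
Proof. by rewrite /cmean /= log_mean_cst. Qed.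

Lemma cmeanD f g : cbmeas f -> cbmeas g ->
  cmean (fun x => f x + g x) = cmean f + cmean g.
Proof.
move=> [rf jf] [rg jg]; rewrite /cmean.
rewrite -[RHS]/((_ + _) +i* (_ + _)) -!log_meanD //.
by congr (_ +i* _); congr log_mean; apply/funext => x; case: (f x) (g x) => ? ? [].
Qed.

Lemma cmeanZ (c : R[i]) f : cbmeas f -> cmean (fun x => c * f x) = c * cmean f.
Proof.
move=> [rf jf]; case: c => a b; rewrite /cmean.
have H k (u : R -> R) : bmeas u -> bmeas (fun x => k * u x).
  by move=> bu; apply: bmeasM => //; exact: bmeas_cst.
rewrite -[RHS]/((_ - _) +i* (_ + _)) -!log_meanZ // -log_meanB -?log_meanD //;
  try exact: H.
by congr (_ +i* _); congr log_mean; apply/funext => x; case: (f x).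
Qed.

Lemma cmeanB f g : cbmeas f -> cbmeas g ->
  cmean (fun x => f x - g x) = cmean f - cmean g.
Proof.
move=> bf bg; rewrite -mulN1r -cmeanZ // -cmeanD //.
  by congr cmean; apply/funext => x; rewrite mulN1r.
by apply: cbmeasM => //; exact: cbmeas_cst.
Qed.

(** The factor [2] comes from estimating the real and imaginary parts
    separately. *)
Lemma cmean_bound f M : cbmeas f -> (forall x, unit x -> `|f x| <= M) ->
  `|cmean f| <= 2 * M.
Proof.
move=> [rf jf] fM.
have u2 : unit 2^-1 by rewrite /= in_itv /= invr_gt0 ltr0n invf_lt1 ?ltr1n.
have M0 : 0 <= M by apply: le_trans (fM _ u2).
have /complex_realP[m ME] : M \is Num.real by rewrite ger0_real.
rewrite ME in fM *.
have HR : `|log_mean s (fun x => complex.Re (f x))| <= m.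
  apply: log_mean_bound => // x ux; rewrite -lecR.
  exact: le_trans (normc_ge_Re _) (fM _ ux).
have HI : `|log_mean s (fun x => complex.Im (f x))| <= m.
  apply: log_mean_bound => // x ux; rewrite -lecR.
  have := le_trans (normc_ge_Re (f x * 'i)) _; rewrite ReiNIm normrN; apply.
  rewrite normrM [X in _ * X](_ : _ = 1) ?mulr1 ?fM //.
  by rewrite normc_def /= expr0n expr1n add0r sqrtr1.
have -> : 2 * m%:C = m%:C + m%:C by rewrite mulr_natl mulr2n.
rewrite [cmean f]complexE; apply: (le_trans (ler_normD _ _)); apply: lerD.
  by rewrite normc_def /= expr0n addr0 sqrtr_sqr lecR.
rewrite normrM [X in X * _](_ : _ = 1) ?mul1r.
  by rewrite normc_def /= expr0n addr0 sqrtr_sqr lecR.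
by rewrite normc_def /= expr0n expr1n add0r sqrtr1.
Qed.

Lemma Fs_cmean t : Fs s t = cmean (fun x => 1 / (1 + t * (x ^+ 2)%:C)).
Proof.
rewrite /Fs /Cintegral /cmean /log_mean.
set I1 := Rintegral _ _ _; set I2 := Rintegral _ _ _.
rewrite -[LHS]/((_ * _ - 0 * _) +i* (_ * _ + 0 * _)) !mul0r subr0 addr0.
congr (_ * _ +i* (_ * _)).
  apply: eq_Rintegral => x _; rewrite /log_weight mul1r; set v := _ `^ _.
  by case: (_^-1) => a b /=; rewrite mul0r subr0.
apply: eq_Rintegral => x _; rewrite /log_weight mul1r; set v := _ `^ _.
by case: (_^-1) => a b /=; rewrite mul0r addr0.
Qed.

End complex_mean.

(** * Derivatives of means of resolvents *)

Section kernel.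
Variables (R : realType) (s c : R).
Hypotheses (s_gt0 : 0 < s) (c_gt0 : 0 < c) (c_le2 : c <= 2).
Notation unit := (`]0%R, 1%R[%classic : set R).
Implicit Types k : R -> R[i].

Let z (x : R) : R := 1 - c * x ^+ 2.

Definition resolvent (w : R[i]) (x : R) : R[i] := (1 - w * (z x)%:C)^-1.

Lemma kernel_var_itv x : unit x -> -1 <= z x < 1.
Proof.
rewrite /= in_itv /= => /andP[x0 x1]; rewrite /z.
have x20 : 0 < x ^+ 2 by rewrite exprn_gt0.
have x21 : x ^+ 2 < 1 by rewrite expr_lt1 // ltW.
apply/andP; split; last by have := mulr_gt0 c_gt0 x20; lra.
have : c * x ^+ 2 <= 2 * 1 by apply: ler_pM => //; exact: ltW.
by lra.
Qed.

Lemma norm_kernel_var_le1 x : unit x -> `|(z x)%:C| <= 1 :> R[i].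
Proof.
move=> /kernel_var_itv/andP[z1 z2]; rewrite normc_def /= expr0n addr0 sqrtr_sqr.
by rewrite lecR ler_norml z1 ltW.
Qed.

Lemma bmeas_kernel_var : bmeas z.
Proof.
apply: bmeasB; first exact: bmeas_cst.
by apply: bmeasM; [exact: bmeas_cst|apply: bmeasX; exact: bmeas_id].
Qed.

Lemma resolvent_den w x : unit x -> 1 - `|w| <= `|1 - w * (z x)%:C|.
Proof.
move=> ux; apply: le_trans (lerB_dist _ _); rewrite normr1 lerD2l lerN2.
by rewrite normrM ler_piMr // norm_kernel_var_le1.
Qed.

Lemma resolvent_neq0 w x : unit x -> `|w| < 1 -> 1 - w * (z x)%:C != 0.
Proof.
move=> ux w1; rewrite -normr_gt0.
by apply: lt_le_trans (resolvent_den w ux); rewrite subr_gt0.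
Qed.

Lemma cbmeas_resolvent w : `|w| < 1 -> cbmeas (resolvent w).
Proof.
move=> w1; pose d := complex.Re (1 - `|w|).
have dE : d%:C = 1 - `|w|.
  by rewrite RRe_real // ger0_real // subr_ge0 ltW.
apply: (@cbmeasV _ _ d).
- by rewrite -ltcR dE subr_gt0.
- by move=> x ux; rewrite dE resolvent_den.
apply: cbmeasD; first exact: cbmeas_cst.
under eq_fun do rewrite -mulNr.
apply: cbmeasM; first exact: cbmeas_cst.
by apply: cbmeas_real; exact: bmeas_kernel_var.
Qed.

Definition resolvent_mean k (m : nat) (w : R[i]) : R[i] :=
  cmean s (fun x => k x * resolvent w x ^+ m).

Lemma norm_resolvent w x : unit x -> `|w| <= 2^-1 -> `|resolvent w x| <= 2.
Proof.
move=> ux w2; have d2 : 2^-1 <= `|1 - w * (z x)%:C|.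
  apply: le_trans (resolvent_den w ux).
  rewrite lerBrDr -lerBrDl (le_trans w2) //.
  by rewrite lerBrDr -[leLHS]mulr2n -[leLHS]mulr_natr mulVf ?pnatr_eq0.
have i2 : 0 < 2^-1 :> R[i] by rewrite invr_gt0.
rewrite /resolvent normfV -[leRHS]invrK lef_pV2 ?posrE //.
exact: lt_le_trans d2.
Qed.

Lemma cbmeas_bound (f : R -> R[i]) : cbmeas f ->
  exists2 M : R[i], 0 <= M & forall x, unit x -> `|f x| <= M.
Proof.
move=> [[_ [M fM]] [_ [L fL]]]; exists (`|M| + `|L|)%:C.
  by rewrite ler0c addr_ge0.
move=> x ux; rewrite [f x]complexE; apply: (le_trans (ler_normD _ _)).
rewrite rmorphD; apply: lerD.
  rewrite normc_def /= expr0n addr0 sqrtr_sqr lecR.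
  by rewrite (le_trans (fM _ ux)) // ler_norm.
rewrite normrM [X in X * _](_ : _ = 1) ?mul1r.
  rewrite normc_def /= expr0n addr0 sqrtr_sqr lecR.
  by rewrite (le_trans (fL _ ux)) // ler_norm.
by rewrite normc_def /= expr0n expr1n add0r sqrtr1.
Qed.

(** Differentiation under the mean. For [w] and [w + h] in the disk of radius
    [1 / 2], resolvents are at most [2] in norm, and [resolvent_powers_taylor]
    bounds the error by [h ^ 2] uniformly in [x]. *)
Lemma is_derive_resolvent_mean k m (w : R[i]^o) : cbmeas k -> `|w| < 4^-1 ->
  is_derive w (1 : R[i]^o) (resolvent_mean k m : R[i]^o -> R[i]^o)
    (resolvent_mean (fun x => m%:R * (k x * (z x)%:C)) m.+1 w).
Proof.
move=> bk w4; have [M M0 kM] := cbmeas_bound bk.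
have [C C0 HC] := @resolvent_powers_taylor R[i] m.
have q0 : 0 < 4^-1 :> R[i] by rewrite invr_gt0.
have half : 4^-1 + 4^-1 = 2^-1 :> R[i].
  rewrite -[LHS]mulr2n -[LHS]mulr_natl.
  have -> : 4 = 2 * 2 :> R[i] by rewrite -natrM.
  by rewrite invfM mulVKf ?pnatr_eq0.
have w2 : `|w| <= 2^-1 by rewrite (le_trans (ltW w4)) // -half lerDl ltW.
have lt21 : 2^-1 < 1 :> R[i] by rewrite invf_lt1 ?ltr1n.
have bz : cbmeas (fun x => (z x)%:C) by apply: cbmeas_real; exact: bmeas_kernel_var.
apply: (@quadratic_is_derive R[i] _ _ _ (2 * (M * C)) 4^-1) => //.
  by rewrite mulr_ge0 // mulr_ge0.
move=> h h4; have hw2 : `|h + w| <= 2^-1.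
  by rewrite (le_trans (ler_normD _ _)) // -half lerD // ltW.
have bu := cbmeas_resolvent (le_lt_trans w2 lt21).
have buh := cbmeas_resolvent (le_lt_trans hw2 lt21).
rewrite /resolvent_mean -cmeanZ //; last first.
  apply: cbmeasM; last exact: cbmeasX.
  by apply: cbmeasM; [exact: cbmeas_cst|exact: cbmeasM].
have b1 : cbmeas (fun x => k x * resolvent (h + w) x ^+ m).
  by apply: cbmeasM => //; exact: cbmeasX.
have b2 : cbmeas (fun x => k x * resolvent w x ^+ m).
  by apply: cbmeasM => //; exact: cbmeasX.
have b3 : cbmeas (fun x => h * (m%:R * (k x * (z x)%:C) * resolvent w x ^+ m.+1)).
  apply: cbmeasM; first exact: cbmeas_cst.
  apply: cbmeasM; last exact: cbmeasX.
  by apply: cbmeasM; [exact: cbmeas_cst|exact: cbmeasM].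
have b12 : cbmeas (fun x => k x * resolvent (h + w) x ^+ m - k x * resolvent w x ^+ m).
  apply: cbmeasD => //; under eq_fun do rewrite -mulN1r.
  by apply: cbmeasM => //; exact: cbmeas_cst.
rewrite -!cmeanB // -!mulrA; apply: cmean_bound => //.
  apply: cbmeasD => //; under eq_fun do rewrite -mulN1r.
  by apply: cbmeasM => //; exact: cbmeas_cst.
move=> x ux.
have -> : k x * resolvent (h + w) x ^+ m - k x * resolvent w x ^+ m -
    h * (m%:R * (k x * (z x)%:C) * resolvent w x ^+ m.+1) =
  k x * (resolvent (h + w) x ^+ m - resolvent w x ^+ m -
    h * (m%:R * (z x)%:C * resolvent w x ^+ m.+1)) by ring.
rewrite normrM; apply: ler_pM => //; first exact: kM.
apply: HC; rewrite ?norm_resolvent ?norm_kernel_var_le1 //.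
have n1 := resolvent_neq0 ux (le_lt_trans w2 lt21).
have n2 := resolvent_neq0 ux (le_lt_trans hw2 lt21).
by rewrite /resolvent; field; rewrite n1 n2.
Qed.

(** Differentiating adds a factor [m + 1] and a factor [z x] under the mean and
    increases the power of the resolvent, so the family is closed under
    derivation and the induction reduces to an identity between binomials. *)
Lemma has_jet_resolvent_mean n k m : cbmeas k ->
  has_jet n (resolvent_mean k m.+1 : R[i]^o -> R[i]^o)
    (fun j => 'C(m + j, j)%:R * cmean s (fun x => k x * (z x)%:C ^+ j)).
Proof.
have bz : cbmeas (fun x => (z x)%:C) by apply: cbmeas_real; exact: bmeas_kernel_var.
have resolvent_mean0 k' m' : resolvent_mean k' m'.+1 0 =
    'C(m' + 0, 0)%:R * cmean s (fun x => k' x * (z x)%:C ^+ 0).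
  rewrite bin0 mul1r; congr cmean; apply/funext => x.
  by rewrite /resolvent mul0r subr0 invr1 expr1n expr0.
elim: n k m => [|n IH] k m bk; first by split.
split; first exact: resolvent_mean0.
exists (resolvent_mean (fun x => m.+1%:R * (k x * (z x)%:C)) m.+2).
  have w4 : \forall w \near (0 : R[i]^o), `|w| < 4^-1.
    by apply: nbhs0_lt; rewrite invr_gt0.
  by apply: filterS w4 => w; exact: is_derive_resolvent_mean.
have bk' : cbmeas (fun x => m.+1%:R * (k x * (z x)%:C)).
  by apply: cbmeasM; [exact: cbmeas_cst|exact: cbmeasM].
apply: eq_has_jet (IH _ m.+1 bk') => j _; rewrite /deriv_coef.
have -> : cmean s (fun x => m.+1%:R * (k x * (z x)%:C) * (z x)%:C ^+ j) =
    m.+1%:R * cmean s (fun x => k x * (z x)%:C ^+ j.+1).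
  rewrite -cmeanZ //; last by apply: cbmeasM => //; exact: cbmeasX.
  by congr cmean; apply/funext => x; rewrite exprS !mulrA.
rewrite !mulrA -!natrM; congr (_%:R * _).
rewrite addnS addSn -mul_bin_diag /= mulnC.
have -> : m.+1 = ((m + j).+1 - j)%N by rewrite -addSn addnK.
by rewrite -mul_bin_down.
Qed.

End kernel.

(** * Tails of the renewal kernel *)

Section kernel_tails.
Variables (R : realType) (s c : R).
Hypotheses (s_gt0 : 0 < s) (c_gt0 : 0 < c) (c_le2 : c <= 2).
Notation unit := (`]0%R, 1%R[%classic : set R).

Let z (x : R) : R := 1 - c * x ^+ 2.

(* The part of the argument that depends on [c]: for [c = 1] it holds because
   [z] is positive, for [c = 2] by the reflection. *)
Hypothesis mean_ge0 : forall phi : R -> R, bmeas (fun x => phi (z x)) ->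
  (forall u : R, 0 < u < 1 -> {for u, continuous phi}) ->
  (forall u : R, 0 < u < 1 -> 0 <= phi u) ->
  (forall u : R, 0 < u < 1 -> - phi u <= phi (- u)) ->
  0 <= log_mean s (fun x => x ^+ 2 * phi (z x)).

(** At [w = 0] this is the Taylor coefficient of [kernel_sum] of index [N + 1];
    in general it is the tail of [kernel_sum] after that many coefficients,
    because the geometric series of [1 / (1 - w * z x)] has the remainder
    [w ^ N * z x ^ N / (1 - w * z x)]. *)
Definition kernel_tail (N : nat) (w : R) : R :=
  log_mean s (fun x => c * x ^+ 2 * (z x ^+ N / (1 - w * z x))).

Definition kernel_sum (w : R) : R := w * kernel_tail 0 w.

Definition kernel_coef (k : nat) : R := if k is j.+1 then kernel_tail j 0 else 0.

Lemma kernel_den (w x : R) : 0 <= w < 1 -> unit x -> 1 - w <= 1 - w * z x.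
Proof.
move=> /andP[w0 w1] /(kernel_var_itv c_gt0 c_le2)/andP[_ z1].
by rewrite lerD2l lerN2 ler_piMr // ltW.
Qed.

Lemma bmeas_kernel_den (w : R) : 0 <= w < 1 -> bmeas (fun x => (1 - w * z x)^-1).
Proof.
move=> w01; apply: (@bmeasV _ _ (1 - w)).
- by case/andP: w01; rewrite subr_gt0.
- by move=> x ux; exact: kernel_den.
apply: bmeasB; first exact: bmeas_cst.
by apply: bmeasM; [exact: bmeas_cst|exact: bmeas_kernel_var].
Qed.

Lemma bmeas_kernel N (w : R) : 0 <= w < 1 ->
  bmeas (fun x => c * x ^+ 2 * (z x ^+ N / (1 - w * z x))).
Proof.
move=> w01; apply: bmeasM; last first.
  by apply: bmeasM; [apply: bmeasX; exact: bmeas_kernel_var|exact: bmeas_kernel_den].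
by apply: bmeasM; [exact: bmeas_cst|apply: bmeasX; exact: bmeas_id].
Qed.

Lemma kernel_tailS N (w : R) : 0 <= w < 1 ->
  kernel_tail N w = kernel_tail N 0 + w * kernel_tail N.+1 w.
Proof.
move=> w01; have b0 : 0 <= (0 : R) < 1 by rewrite lexx ltr01.
rewrite /kernel_tail -log_meanZ -?log_meanD //; try exact: bmeas_kernel.
  apply: eq_log_mean => x ux; have d0 : 1 - w * z x != 0.
    rewrite gt_eqF // (lt_le_trans _ (kernel_den w01 ux)) // subr_gt0.
    by case/andP: w01.
  by rewrite mul0r subr0 divr1 [z x ^+ N.+1]exprS; move: d0; set y := z x => d0; field.
by apply: bmeasM; [exact: bmeas_cst|exact: bmeas_kernel].
Qed.

Lemma kernel_sumE N (w : R) : 0 <= w < 1 -> kernel_sum w =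
  \sum_(k < N.+1) kernel_coef k * w ^+ k + w ^+ N.+1 * kernel_tail N w.
Proof.
move=> w01; elim: N => [|N IH].
  by rewrite big_ord1 /= mul0r add0r expr1.
rewrite IH [in RHS]big_ord_recr /= -[RHS]addrA; congr (_ + _).
by rewrite (kernel_tailS N w01) [w ^+ N.+2]exprS; ring.
Qed.

(** Multiplication by [z ^ N] changes the value at [- u] by a sign at most, so
    that [psi (- u) <= psi u] is enough to compare opposite points, whatever the
    parity of [N]. *)
Lemma weighted_power_ge0 (psi : R -> R) N :
  bmeas (fun x => psi (z x)) ->
  (forall u : R, 0 < u < 1 -> {for u, continuous psi}) ->
  (forall u : R, 0 < u < 1 -> 0 <= psi (- u) <= psi u) ->
  0 <= log_mean s (fun x => c * x ^+ 2 * (z x ^+ N * psi (z x))).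
Proof.
move=> bpsi cpsi psi0.
have bN : bmeas (fun x => z x ^+ N * psi (z x)).
  by apply: bmeasM => //; apply: bmeasX; exact: bmeas_kernel_var.
have -> : log_mean s (fun x => c * x ^+ 2 * (z x ^+ N * psi (z x))) =
    c * log_mean s (fun x => x ^+ 2 * (z x ^+ N * psi (z x))).
  rewrite -log_meanZ //; last by apply: bmeasM => //; apply: bmeasX; exact: bmeas_id.
  by congr log_mean; apply/funext => x; rewrite -mulrA.
apply: mulr_ge0; first exact: ltW.
apply: (mean_ge0 (phi := fun u => u ^+ N * psi u)) => //.
- by move=> u u01; apply: cvgM; [exact: exprn_continuous|exact: cpsi].
- move=> u u01; have /andP[p0 p1] := psi0 _ u01; case/andP: u01 => u0 _ /=.
  by rewrite mulr_ge0 ?(le_trans p0 p1) // exprn_ge0 // ltW.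
- move=> u u01; have /andP[p0 p1] := psi0 _ u01; case/andP: u01 => u0 _.
  have uN : 0 <= u ^+ N by rewrite exprn_ge0 // ltW.
  rewrite /= exprNn; have [] : (-1) ^+ N = 1 :> R \/ (-1) ^+ N = -1 :> R.
    by rewrite -signr_odd; case: odd; [right|left]; rewrite ?expr1 ?expr0.
  + move=> ->; rewrite mul1r; apply: (@le_trans _ _ 0); last exact: mulr_ge0.
    by rewrite oppr_le0 mulr_ge0 // (le_trans p0 p1).
  + by move=> ->; rewrite mulN1r mulNr lerN2 ler_wpM2l.
Qed.

Lemma kernel_den_gt0 (u w : R) : 0 <= w < 1 -> -1 < u < 1 -> 0 < 1 - w * u.
Proof. by move=> /andP[w0 w1] /andP[u0 u1]; nra. Qed.

Lemma continuous_kernel_den (w u : R) : 0 <= w < 1 -> -1 < u < 1 ->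
  {for u, continuous (fun u => (1 - w * u)^-1)}.
Proof.
move=> w01 u01; apply: cvgV; first by rewrite gt_eqF // kernel_den_gt0.
by apply: cvgB; [exact: cvg_cst|apply: cvgM; [exact: cvg_cst|exact: cvg_id]].
Qed.

Lemma kernel_den_sym (w u : R) : 0 <= w < 1 -> 0 < u < 1 ->
  0 <= (1 - w * - u)^-1 <= (1 - w * u)^-1.
Proof.
move=> w01 u01; case/andP: (u01) => u0 u1; case/andP: (w01) => w0 w1.
have d1 : 0 < 1 - w * - u by apply: kernel_den_gt0 => //; lra.
have d2 : 0 < 1 - w * u by apply: kernel_den_gt0 => //; lra.
by rewrite invr_ge0 (ltW d1) lef_pV2 ?posrE //=; nra.
Qed.

Lemma kernel_tail_ge0 N (w : R) : 0 <= w < 1 -> 0 <= kernel_tail N w.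
Proof.
move=> w01; apply: (weighted_power_ge0 (psi := fun u => (1 - w * u)^-1)).
- exact: bmeas_kernel_den.
- by move=> u u01; apply: continuous_kernel_den => //; lra.
- by move=> u u01; exact: kernel_den_sym.
Qed.

(** The difference of two resolvents is, up to the factor [z], their product:
    the difference of the tails is a mean of the same shape, with one more power
    of [z] and [psi] the product of the two resolvents. *)
Lemma kernel_tail_mono N (w w' : R) : 0 <= w < 1 -> w <= w' < 1 ->
  kernel_tail N w <= kernel_tail N w'.
Proof.
move=> w01 /andP[ww w'1].
have w'01 : 0 <= w' < 1 by rewrite (le_trans _ ww) //; case/andP: w01.
rewrite -subr_ge0 /kernel_tail -log_meanB //; try exact: bmeas_kernel.
pose psi u := (w' - w) * ((1 - w * u)^-1 * (1 - w' * u)^-1).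
rewrite (@eq_log_mean _ _ _ (fun x => c * x ^+ 2 * (z x ^+ N.+1 * psi (z x)))).
  apply: weighted_power_ge0.
  - apply: bmeasM; first exact: bmeas_cst.
    by apply: bmeasM; exact: bmeas_kernel_den.
  - move=> u u01; apply: cvgM; first exact: cvg_cst.
    by apply: cvgM; apply: continuous_kernel_den => //; lra.
  - move=> u u01; have /andP[a1 a2] := kernel_den_sym w01 u01.
    have /andP[b1 b2] := kernel_den_sym w'01 u01.
    have d0 : 0 <= w' - w by rewrite subr_ge0.
    by rewrite /psi !mulr_ge0 //= ler_wpM2l // ler_pM.
move=> x ux; rewrite /psi [z x ^+ N.+1]exprS.
have n1 : 1 - w * z x != 0.
  rewrite gt_eqF // (lt_le_trans _ (kernel_den w01 ux)) // subr_gt0.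
  by case/andP: w01.
have n2 : 1 - w' * z x != 0.
  by rewrite gt_eqF // (lt_le_trans _ (kernel_den w'01 ux)) // subr_gt0.
by field; rewrite n1 n2.
Qed.

(** This coefficient is the explicit moment [c / 3 ^ s]. *)
Lemma kernel_coef1_gt0 : 0 < kernel_coef 1.
Proof.
rewrite /kernel_coef /kernel_tail.
rewrite (@eq_log_mean _ _ _ (fun x => c * x ^+ 2)); last first.
  by move=> x _; rewrite expr0 mul0r subr0 divr1 mulr1.
rewrite log_meanZ //; last by apply: bmeasX; exact: bmeas_id.
by rewrite log_mean_expr // mulr_gt0 // invr_gt0 powR_gt0.
Qed.

Lemma one_sub_kernel_sum (w : R) : 0 <= w < 1 ->
  1 - kernel_sum w = log_mean s (fun x => (1 - w) * (1 - w * z x)^-1).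
Proof.
move=> w01; have bk := bmeas_kernel 0 w01.
rewrite /kernel_sum /kernel_tail -log_meanZ // -[X in X - _](log_mean_cst s_gt0 1).
rewrite -log_meanB //; last 2 first.
- exact: bmeas_cst.
- by apply: bmeasM => //; exact: bmeas_cst.
apply: eq_log_mean => x ux.
have n1 : 1 - w * z x != 0.
  rewrite gt_eqF // (lt_le_trans _ (kernel_den w01 ux)) // subr_gt0.
  by case/andP: w01.
by rewrite expr0; move: n1; rewrite /z => n1; field.
Qed.

Lemma kernel_sum_lower (w m : R) : 0 <= w < 1 -> 0 < m ->
  (forall x, unit x -> 1 - w * z x <= m) -> (1 - w) / m <= 1 - kernel_sum w.
Proof.
move=> w01 m0 zm; rewrite one_sub_kernel_sum //.
rewrite -[leLHS](log_mean_cst s_gt0); case/andP: (w01) => w0 w1.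
apply: le_log_mean => //; first exact: bmeas_cst.
  by apply: bmeasM; [exact: bmeas_cst|exact: bmeas_kernel_den].
move=> x ux; rewrite ler_pM2l ?subr_gt0 // lef_pV2 ?posrE ?zm //.
by rewrite (lt_le_trans _ (kernel_den w01 ux)) // subr_gt0.
Qed.

Lemma kernel_sum_lt1 (w : R) : 0 <= w < 1 -> kernel_sum w < 1.
Proof.
move=> w01; case/andP: (w01) => w0 w1; rewrite -subr_gt0.
apply: lt_le_trans (kernel_sum_lower (m := 1 + w) w01 _ _).
- by rewrite divr_gt0 ?subr_gt0 // ltr_wpDr.
- by rewrite ltr_wpDr.
- by move=> x /(kernel_var_itv c_gt0 c_le2)/andP[z1 _]; rewrite -/(z x) in z1; nra.
Qed.

Lemma Fs_real (w : R) : 0 <= w < 1 -> Fs s (c * w / (1 - w))%:C = (1 - kernel_sum w)%:C.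
Proof.
move=> w01; rewrite one_sub_kernel_sum // Fs_cmean // -cmean_real //.
apply: eq_cmean => x ux; case/andP: (w01) => w0 w1.
rewrite -rmorphM -(rmorph1 (real_complex R)) -rmorphD -fmorph_div.
congr _%:C.
have n1 : 1 - w * z x != 0.
  by rewrite gt_eqF // (lt_le_trans _ (kernel_den w01 ux)) // subr_gt0.
have n2 : 1 - w != 0 by rewrite gt_eqF // subr_gt0.
have -> : 1 + c * w / (1 - w) * x ^+ 2 = (1 - w * z x) / (1 - w).
  by rewrite /z; field.
by rewrite div1r invf_div.
Qed.

End kernel_tails.

(** * Taylor coefficients and remainders *)

Section remainder.
Variables (R : realType) (s c : R).
Hypotheses (s_gt0 : 0 < s) (c_gt0 : 0 < c) (c_le2 : c <= 2).
Notation unit := (`]0%R, 1%R[%classic : set R).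

Let z (x : R) : R := 1 - c * x ^+ 2.

(** With [c = 1] and [c = 2] these are the two functions whose inverse powers are
    expanded. *)
Definition Fs_disk (w : R[i]) : R[i] := Fs s (c%:C * w / (1 - w)).

Lemma Fs_diskE (w : R[i]) : `|w| < 1 ->
  Fs_disk w = 1 + w * resolvent_mean s c (fun x => (- (c * x ^+ 2))%:C) 1 w.
Proof.
move=> w1; rewrite /Fs_disk /resolvent_mean Fs_cmean //.
have bk : cbmeas (fun x : R => (- (c * x ^+ 2))%:C * resolvent c w x ^+ 1).
  apply: cbmeasM; last by apply: cbmeasX; exact: cbmeas_resolvent.
  apply: cbmeas_real; apply: bmeasN; apply: bmeasM; first exact: bmeas_cst.
  by apply: bmeasX; exact: bmeas_id.
have cmean_one : cmean s (fun=> 1) = 1.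
  by rewrite -[X in fun=> X]/(1%:C) cmean_real // log_mean_cst.
rewrite -cmeanZ // -[X in X + cmean _ _]cmean_one -cmeanD //; last 2 first.
- exact: cbmeas_cst.
- by apply: cbmeasM => //; exact: cbmeas_cst.
apply: eq_cmean => x ux; rewrite expr1 /resolvent.
have := resolvent_neq0 c_gt0 c_le2 ux w1.
have n2 : 1 - w != 0.
  by apply: contraTneq w1 => /eqP; rewrite subr_eq0 => /eqP <-; rewrite normr1 ltxx.
have CXE : (c * x ^+ 2)%:C = c%:C * (x ^+ 2)%:C by exact: rmorphM.
have -> : (1 - c * x ^+ 2)%:C = 1 - c%:C * (x ^+ 2)%:C.
  by rewrite -CXE; exact: rmorphB.
have -> : (- (c * x ^+ 2))%:C = - (c%:C * (x ^+ 2)%:C).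
  by rewrite -CXE; exact: rmorphN.
move: (c%:C) ((x ^+ 2)%:C) => C X n1.
have -> : 1 + C * w / (1 - w) * X = (1 - w * (1 - C * X)) / (1 - w) by field.
by field; rewrite n1 n2.
Qed.

Lemma has_jet_Fs_disk n : has_jet n (Fs_disk : R[i]^o -> R[i]^o)
  (fun k => unit_coef R[i] k - (kernel_coef s c k)%:C).
Proof.
have bk : cbmeas (fun x : R => (- (c * x ^+ 2))%:C).
  apply: cbmeas_real; apply: bmeasN; apply: bmeasM; first exact: bmeas_cst.
  by apply: bmeasX; exact: bmeas_id.
have jG := has_jet_resolvent_mean s_gt0 c_gt0 c_le2 n 0 bk.
have jH := has_jetD (has_jet_cst n 1) (has_jetM (has_jet_id R[i] n) jG).
have near1 : \forall w \near (0 : R[i]^o), `|w| < 1 by apply: nbhs0_lt.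
apply: (near_eq_has_jet (f := fun w =>
    1 + w * resolvent_mean s c (fun x => (- (c * x ^+ 2))%:C) 1 w)).
  by apply: filterS near1 => w w1; rewrite Fs_diskE.
apply: eq_has_jet jH => k _; case: k => [|k].
  by rewrite /conv big_ord1 /= mul0r addr0 subr0.
rewrite conv_delta1 add0n binn mul1r /unit_coef /= !add0r.
rewrite (_ : cmean _ _ = cmean s (fun x =>
    (- (c * x ^+ 2 * (z x ^+ k / (1 - 0 * z x))))%:C)); last first.
  apply: eq_cmean => x _; rewrite mul0r subr0 divr1 -[- (c * _ * _)]mulNr.
  transitivity ((- (c * x ^+ 2))%:C * (z x ^+ k)%:C).
    by congr (_ * _);  apply/esym; exact: rmorphXn.
  by apply/esym; exact: rmorphM.
rewrite cmean_real // -raddfN /=; congr _%:C.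
rewrite /kernel_tail -mulN1r -log_meanZ //.
  by congr log_mean; apply/funext => x; rewrite mulN1r.
by apply: bmeas_kernel => //; rewrite lexx ltr01.
Qed.

Lemma beta_kernel_sum (w : R) : 0 <= w < 1 -> c * w / (1 - w) = 1 ->
  dirichlet_beta s = 1 - kernel_sum s c w.
Proof.
move=> w01 cw; apply: complexI; rewrite -Fs_real // cw Fs_cmean //.
rewrite dirichlet_beta_log_mean // -cmean_real //; apply: eq_cmean => x _.
rewrite div1r fmorphV; congr (_^-1).
transitivity (1%:C + (x ^+ 2)%:C); first exact: rmorphD.
by congr (_ + _); apply/esym; exact: mul1r.
Qed.

Hypothesis mean_ge0 : forall phi : R -> R, bmeas (fun x => phi (z x)) ->
  (forall u : R, 0 < u < 1 -> {for u, continuous phi}) ->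
  (forall u : R, 0 < u < 1 -> 0 <= phi u) ->
  (forall u : R, 0 < u < 1 -> - phi u <= phi (- u)) ->
  0 <= log_mean s (fun x => x ^+ 2 * phi (z x)).

(** The same sequence [q], the solution of the renewal equation, gives the
    Taylor coefficients through complex jets and carries the tails on [0, 1). *)
Lemma taylor_remainder (r N : nat) (w rho : R) : c * w / (1 - w) = 1 ->
  0 < w -> w < rho -> rho < 1 ->
  exists2 t : R,
    (dirichlet_beta s ^- r.+1)%:C - \sum_(0 <= n < N.+1)
      taylor_coef (fun u => Fs_disk u ^- r.+1) n * w%:C ^+ n = t%:C &
    0 < t <= (w / rho) ^+ N.+1 * (1 - kernel_sum s c rho) ^- r.+1.
Proof.
move=> cw w0 wrho rho1.
have w01 : 0 <= w < 1 by rewrite (ltW w0) (lt_trans wrho).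
pose p := kernel_coef s c.
have p0 : p 0%N = 0 by [].
have b0 : 0 <= (0 : R) < 1 by rewrite lexx ltr01.
have p_ge0 k : 0 <= p k by case: k => [|k] //; exact: kernel_tail_ge0.
have p1 : 0 < p 1%N by exact: kernel_coef1_gt0.
have [q qE] := renewal_ex p0.
have tails : pos_tails (fun u => (1 - kernel_sum s c u)^-1) q.
  apply: (pos_tails_geometric (T := kernel_tail s c) p0) => //.
  - by move=> u; exact: kernel_sum_lt1.
  - move=> u u01; apply: (lt_le_trans p1); apply: kernel_tail_mono => //.
  - move=> M u u01; split; first exact: kernel_tail_ge0.
      exact: kernel_sumE.
    by move=> u'; exact: kernel_tail_mono.
have coefE n : taylor_coef (fun u => Fs_disk u ^- r.+1) n = (conv_pow q r.+1 n)%:C.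
  (* The renewal equation is transported from the reals to the complex numbers. *)
have qcE k : (q k)%:C = unit_coef R[i] k +
      conv (real_complex R \o q) (real_complex R \o p) k.
    by rewrite conv_rmorph {1}qE rmorphD /= /unit_coef rmorph_nat.
  have := has_jet_geometric (p := real_complex R \o p) (q := real_complex R \o q)
    erefl qcE (has_jet_Fs_disk n).
  move=> /(has_jet_conv_pow r.+1)/has_jet_derive1n.
  rewrite conv_pow_rmorph /taylor_coef => jE.
  have -> : (fun u => Fs_disk u ^- r.+1) = (fun u => (Fs_disk u)^-1 ^+ r.+1).
    by apply/funext => u; rewrite exprVn.
  by rewrite jE mulrAC divff ?mul1r // pnatr_eq0 -lt0n fact_gt0.
have := pos_tails_remainder N.+1 (pos_tails_conv_pow r tails) w0 wrho rho1.
rewrite !exprVn; set t := _ - _ => tB; exists t => //.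
under eq_bigr do rewrite coefE.
rewrite /t (beta_kernel_sum w01 cw) big_mkord rmorphB rmorph_sum.
by congr (_ - _); apply: eq_bigr => k _; rewrite rmorphM rmorphXn.
Qed.

End remainder.

(** * The remainder estimates *)

Lemma le_remainder_bound (R : realType) (r N : nat) (t w rho m H : R) :
  0 < w -> 0 < rho -> 0 < m -> m <= H ->
  t <= (w / rho) ^+ N * H ^- r -> t <= m ^- r * (w / rho) ^+ N.
Proof.
move=> w0 rho0 m0 mH tB; apply: (le_trans tB); rewrite mulrC ler_wpM2r //.
  by rewrite exprn_ge0 // divr_ge0 // ltW.
have H0 := lt_le_trans m0 mH.
by rewrite lef_pV2 ?posrE ?exprn_gt0 // lerXn2r ?nnegrE // ltW.
Qed.

(* The inequalities are in the partial order of R[i]: x <= y and x < y include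
   the equality of the imaginary parts, so they also say that rem2 and rem3, which
   are built from complex Taylor coefficients, are real. *)
Theorem theorem4p7 (R : realType) (r N : nat) (r_ge1 : (1 <= r)%N) :
  (forall s : R, 0 < s -> forall rho : R, 1 / 2 < rho < 1 ->
    0 < rem2 s r N
      <= ((1 / (2 * rho)) ^+ N.+1)%:C * Fs s (rho / (1 - rho))%:C ^- r
    /\ rem2 s r N <= ((1 - rho) ^- r * (1 / (2 * rho)) ^+ N.+1)%:C)
  /\
  (forall s : R, 2 <= s -> forall rho : R, 1 / 3 < rho < 1 ->
    0 < rem3 s r N
      <= ((1 / (3 * rho)) ^+ N.+1)%:C * Fs s (2 * rho / (1 - rho))%:C ^- r
    /\ rem3 s r N
      <= (((1 + rho) / (1 - rho)) ^+ r * (1 / (3 * rho)) ^+ N.+1)%:C).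
Proof.
case: r r_ge1 => [//|r] _.
have natV n k : (n%:R^-1 : R)%:C ^+ k = n%:R ^- k.
  by rewrite fmorphV rmorph_nat exprVn.
split=> s sB rho /andP[rho_gt rho1]; rewrite div1r in rho_gt.
- have rho0 : 0 < rho by apply: lt_trans rho_gt; rewrite invr_gt0.
  have rho01 : 0 <= rho < 1 by rewrite (ltW rho0).
  have mean_ge0 (phi : R -> R) : bmeas (fun x => phi (1 - 1 * x ^+ 2)) ->
    (forall u : R, 0 < u < 1 -> {for u, continuous phi}) ->
    (forall u : R, 0 < u < 1 -> 0 <= phi u) ->
    (forall u : R, 0 < u < 1 -> - phi u <= phi (- u)) ->
    0 <= log_mean s (fun x => x ^+ 2 * phi (1 - 1 * x ^+ 2)).
    move=> bphi _ phi0 _; apply: log_mean_ge0 => //.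
      by apply: bmeasM => //; apply: bmeasX; exact: bmeas_id.
    move=> x; rewrite /= in_itv /= => /andP[x0 x1].
    rewrite mulr_ge0 ?sqr_ge0 // phi0 // mul1r.
    have : 0 < x ^+ 2 by rewrite exprn_gt0.
    have : x ^+ 2 < 1 by rewrite expr_lt1 // ltW.
    by lra.
  have c2 : 1 <= 2 :> R by rewrite ler1n.
  have half : 1 * 2^-1 / (1 - 2^-1) = 1 :> R by field.
  have [t tE tB] := taylor_remainder sB ltr01 c2 mean_ge0 r N half
    (eqbRL (invr_gt0 2) (ltr0n _ 2)) rho_gt rho1.
  have -> : rem2 s r.+1 N = t%:C.
    have HE : Fs_disk s 1 = Hs s.
      by apply/funext => u; rewrite /Fs_disk mul1r.
    by rewrite -tE HE /rem2; under [X in _ = _ - X]eq_bigr do rewrite natV.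
  have -> : 1 / (2 * rho) = 2^-1 / rho by rewrite div1r invfM.
  have FE := Fs_real sB ltr01 c2 rho01; rewrite mul1r in FE.
  rewrite FE -rmorphXn -fmorphV -rmorphM ltcR !lecR; split=> //.
  apply: (@le_remainder_bound _ _ _ _ _ _ _ (1 - kernel_sum s 1 rho)) => //.
  + by rewrite subr_gt0.
  + have := kernel_sum_lower sB ltr01 c2 rho01 (@ltr01 R); rewrite divr1; apply.
    move=> x; rewrite /= in_itv /= => /andP[x0 x1].
    have : x ^+ 2 < 1 by rewrite expr_lt1 // ltW.
    by rewrite mul1r; set y := x ^+ 2 => y1; nra.
  + by case/andP: tB.
- have s0 : 0 < s by exact: lt_le_trans sB.
  have rho0 : 0 < rho by apply: lt_trans rho_gt; rewrite invr_gt0.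
  have rho01 : 0 <= rho < 1 by rewrite (ltW rho0).
  have c0 : 0 < 2 :> R by rewrite ltr0n.
  have mean_ge0 := log_mean_pairing sB.
  have third : 2 * 3^-1 / (1 - 3^-1) = 1 :> R by field.
  have [t tE tB] := taylor_remainder s0 c0 (lexx _) mean_ge0 r N third
    (eqbRL (invr_gt0 3) (ltr0n _ 3)) rho_gt rho1.
  have -> : rem3 s r.+1 N = t%:C.
    have AE : Fs_disk s 2 = As s.
      by apply/funext => u; rewrite /Fs_disk rmorph_nat.
    by rewrite -tE AE /rem3; under [X in _ = _ - X]eq_bigr do rewrite natV.
  have -> : 1 / (3 * rho) = 3^-1 / rho by rewrite div1r invfM.
  rewrite (Fs_real s0 c0 (lexx _) rho01).
  rewrite -rmorphXn -fmorphV -rmorphM ltcR !lecR; split=> //.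
  have -> : ((1 + rho) / (1 - rho)) ^+ r.+1 = ((1 - rho) / (1 + rho)) ^- r.+1.
    by rewrite -exprVn invf_div.
  have rhoD : 0 < 1 + rho by rewrite addr_gt0.
  apply: (@le_remainder_bound _ _ _ _ _ _ _ (1 - kernel_sum s 2 rho)) => //.
  + by rewrite divr_gt0 // subr_gt0.
  + apply: kernel_sum_lower => // x ux.
    have /andP[z1 _] := kernel_var_itv c0 (lexx _) ux.
    by move: z1; set y := 1 - _ => z1; nra.
  + by case/andP: tB.
Qed.
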